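(* Let $r>0$ and let $f:C^0([-r,0];\mathbb{R}^n)\to\mathbb{R}^n$ satisfy $f(0)=0$ and be Lipschitz on bounded sets of $C^0([-r,0];\mathbb{R}^n)$. Let $p\in(1,+\infty]$ and let $X$ denote the space $W^{1,p}([-r,0])$ or the space $C^{0,1-1/p}([-r,0])$. For the system $\dot x(t)=f(x_t)$, property (UGAS-X) holds if and only if there exist a functional $V:X\to\mathbb{R}_+$ which is Lipschitz on bounded sets of $X$ and functions $a_1,a_2\in K_\infty$ such that the following inequalities hold for all $x\in X$: $$a_1(\|x\|_X)\le V(x)\le a_2(\|x\|_X),$$ $$V(\phi(t,x))\le \exp(-t)\,V(x)\quad\text{for all } t\ge0 .$$
   Context: $|\cdot|$ is the Euclidean norm on $\mathbb{R}^n$ and $\mathbb{R}_+=[0,+\infty)$. $C^0([-r,0];\mathbb{R}^n)$ is the space of continuous functions with norm $\|x\|_\infty=\max_{s\in[-r,0]}|x(s)|$. $f$ is Lipschitz on bounded sets of $C^0([-r,0];\mathbb{R}^n)$ if there is a non-decreasing function $L:\mathbb{R}_+\to\mathbb{R}_+$ such that for every $R\ge 0$, $|f(x)-f(y)|\le L(R)\|x-y\|_\infty$ for all $x,y$ with $\|x\|_\infty\le R$, $\|y\|_\infty\le R$. For the system $\dot x(t)=f(x_t)$, $x(t)\in\mathbb{R}^n$ and $x_t\in C^0([-r,0];\mathbb{R}^n)$ is defined by $x_t(s)=x(t+s)$, $s\in[-r,0]$. For $x_0\in C^0([-r,0];\mathbb{R}^n)$, $\phi(t,x_0)$ denotes $x_t$,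 where $x(t)$ is the (unique, maximally defined for $t\ge0$) solution with initial condition $x_0$. Every condition involving $\phi(t,x_0)$ for all $t\ge 0$ is understood to include existence of the solution for all $t\ge0$. Function spaces ($1/p:=0$ when $p=+\infty$). $W^{1,p}([-r,0])$ is the space of absolutely continuous $x:[-r,0]\to\mathbb{R}^n$ with $\dot x\in L^p((-r,0);\mathbb{R}^n)$, with norm $\|x\|_X=\|x\|_\infty+\|\dot x\|_p$, where $\|\dot x\|_p=(\int_{-r}^0|\dot x(s)|^p ds)^{1/p}$ for $p<+\infty$ and the essential supremum of $|\dot x|$ for $p=+\infty$. For $a\in(0,1]$, $C^{0,a}([-r,0])$ is the space of $x\in C^0([-r,0];\mathbb{R}^n)$ with $\sup_{t,s\in[-r,0],t\ne s}|x(t)-x(s)|/|t-s|^a<+\infty$, with norm $\|x\|_X=\max\left(\|x\|_\infty,\sup_{t\ne s}|x(t)-x(s)|/|t-s|^a\right)$. If $x_0\in X$, with $X$ one of these spaces, then $\phi(t,x_0)\in X$ whenever it exists. A functional $V:X\to\mathbb{R}_+$ is Lipschitz on bounded sets of $X$ if for every $R\ge0$ there is a constant $M\ge 0$ with $|V(x)-V(y)|\le M\|x-y\|_X$ for all $x,y\in X$ with $\|x\|_X\le R$, $\|y\|_X\le R$. Class $K$: strictly increasing continuous functions $\rho:\mathbb{R}_+\to\mathbb{R}_+$ with $\rho(0)=0$. Class $K_\infty$: functions $\rho$ of class $K$ with $\lim_{s\to+\infty}\rho(s)=+\infty$. Class $KL$: functions $\sigma:\mathbb{R}_+\times\mathbb{R}_+\to\mathbb{R}_+$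 such that $\sigma(\cdot,t)$ is of class $K$ for each $t\ge0$, and $\sigma(s,\cdot)$ is non-increasing with $\lim_{t\to+\infty}\sigma(s,t)=0$ for each $s\ge0$. (UGAS-X): there exists $\sigma\in KL$ such that $\|\phi(t,x_0)\|_X\le\sigma(\|x_0\|_X,t)$ for all $t\ge0$ and all $x_0\in X$. *)

(* Defs.v *)
From HB Require Import structures.
From mathcomp Require Import all_boot all_order all_algebra.
From mathcomp Require Import all_classical all_reals all_analysis.
Set Implicit Arguments.
Unset Strict Implicit.
Unset Printing Implicit Defensive.
Import Order.TTheory GRing.Theory Num.Theory.
Import numFieldNormedType.Exports.
Local Open Scope classical_set_scope.
Local Open Scope ring_scope.

(* A function on [-r, 0] is represented by a total function R -> 'rV[R]_n, of
   which only the restriction to [-r, 0] matters: every predicate and norm below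
   depends on that restriction only.  A functional on a space of such functions
   is likewise a map defined on all of R -> 'rV[R]_n and constrained only on the
   members of the space; being Lipschitz on bounded sets forces it to take equal
   values on two members that agree on [-r, 0], since the norm of their
   difference is 0. *)

(* The library norm `|v| on 'rV[R]_n is the sup norm; it induces the same
   topology as the Euclidean one. *)
Definition enorm (R : realType) (n : nat) (v : 'rV[R]_n) : R :=
  Num.sqrt (\sum_(i < n) v 0 i ^+ 2).

Definition in_C0 (R : realType) (n : nat) (r : R) (x : R -> 'rV[R]_n) : Prop :=
  {within `[- r, 0], continuous x}.

Definition supnorm (R : realType) (n : nat) (r : R) (x : R -> 'rV[R]_n) : R :=
  sup [set enorm (x s) | s in `[- r, 0]].

Definition lipschitz_bounded_C0 (R : realType) (n : nat) (r : R)
    (f : (R -> 'rV[R]_n) -> 'rV[R]_n) : Prop :=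
  exists L : R -> R,
    [/\ forall s : R, 0 <= s -> 0 <= L s,
        forall s t : R, 0 <= s -> s <= t -> L s <= L t
      & forall rho : R, 0 <= rho -> forall x y, in_C0 r x -> in_C0 r y ->
          supnorm r x <= rho -> supnorm r y <= rho ->
          enorm (f x - f y) <= L rho * supnorm r (x - y)].

(* x_t *)
Definition history (R : realType) (n : nat) (x : R -> 'rV[R]_n) (t : R) :
    R -> 'rV[R]_n :=
  fun s => x (t + s).

(* x : [-r, +oo) -> R^n is a solution of x'(t) = f(x_t) for all t >= 0 with
   initial condition x0; at t = 0 the derivative is the right derivative.
   Then phi(t, x0) is [history x t]; the solution is unique on [-r, +oo) when f
   is Lipschitz on bounded sets. *)
Definition global_solution (R : realType) (n : nat) (r : R)
    (f : (R -> 'rV[R]_n) -> 'rV[R]_n) (x0 x : R -> 'rV[R]_n) : Prop :=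
  [/\ {within `[- r, +oo[, continuous x},
      forall s : R, - r <= s <= 0 -> x s = x0 s,
      h^-1 *: (x h - x 0) @[h --> 0^'+] --> f (history x 0)
    & forall t : R, 0 < t -> is_derive t 1 x (f (history x t))].

Record funspace (R : realType) (n : nat) := Funspace {
  fs_mem : (R -> 'rV[R]_n) -> Prop;
  fs_norm : (R -> 'rV[R]_n) -> R }.

(* Absolute continuity on [a, b]; the k-th of the m non-overlapping
   subintervals is [u k, v k]. *)
Definition abs_continuous (R : realType) (n : nat) (a b : R)
    (x : R -> 'rV[R]_n) : Prop :=
  forall eps : R, 0 < eps -> exists2 delta : R, 0 < delta &
    forall (m : nat) (u v : 'I_m -> R),
      (forall k, [/\ a <= u k, u k <= v k & v k <= b]) ->
      (forall k l, k != l -> v k <= u l \/ v l <= u k) ->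
      \sum_(k < m) (v k - u k) < delta ->
      \sum_(k < m) enorm (x (v k) - x (u k)) < eps.

Definition Lnorm_derivative (R : realType) (n : nat) (r : R) (p : \bar R)
    (x : R -> 'rV[R]_n) : \bar R :=
  let D : set R := `]- r, 0[%classic in
  let g : R -> R := (fun s => enorm (derive1 x s)) \_ D in
  ('N[lebesgue_measure]_p[EFin \o g])%E.

(* derive1 x is a total function with a junk value where x is not differentiable;
   differentiability a.e., which absolute continuity implies, is spelled out as
   part of the meaning of "x' is in L^p". *)
Definition in_W1 (R : realType) (n : nat) (r : R) (p : \bar R)
    (x : R -> 'rV[R]_n) : Prop :=
  [/\ abs_continuous (- r) 0 x,
      {ae lebesgue_measure, forall s : R, s \in `]- r, 0[ -> derivable x s 1},
      forall i : 'I_n, measurable_fun `]- r, 0[ (fun s : R => derive1 x s 0 i)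
    & (Lnorm_derivative r p x < +oo)%E].

Definition W1 (R : realType) (n : nat) (r : R) (p : \bar R) : funspace R n :=
  Funspace (in_W1 r p)
    (fun x => supnorm r x + fine (Lnorm_derivative r p x)).

Definition hoelder_quotients (R : realType) (n : nat) (r a : R)
    (x : R -> 'rV[R]_n) : set R :=
  [set q | exists t s : R, [/\ t \in `[- r, 0], s \in `[- r, 0], t != s
                         & q = enorm (x t - x s) / (`|t - s| `^ a)]].

Definition C0a (R : realType) (n : nat) (r a : R) : funspace R n :=
  Funspace
    (fun x => in_C0 r x /\ has_ubound (hoelder_quotients r a x))
    (fun x => Num.max (supnorm r x) (sup (hoelder_quotients r a x))).

(* 1 / p, with 1 / +oo = 0 *)
Definition recip (R : realType) (p : \bar R) : R :=
  if p is q%:E then q^-1 else 0.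

Definition lipschitz_bounded (R : realType) (n : nat) (X : funspace R n)
    (V : (R -> 'rV[R]_n) -> R) : Prop :=
  forall rho : R, 0 <= rho -> exists2 M : R, 0 <= M &
    forall x y, fs_mem X x -> fs_mem X y ->
      fs_norm X x <= rho -> fs_norm X y <= rho ->
      `|V x - V y| <= M * fs_norm X (x - y).

(* Comparison functions on [0, +oo); values at negative arguments are junk, and
   nonnegativity of the values follows from rho 0 = 0 and monotonicity. *)
Definition classK (R : realType) (rho : R -> R) : Prop :=
  [/\ {within `[0, +oo[, continuous rho},
      forall s t : R, 0 <= s -> s < t -> rho s < rho t
    & rho 0 = 0].

Definition classKinf (R : realType) (rho : R -> R) : Prop :=
  classK rho /\ rho s @[s --> +oo] --> +oo.

Definition classKL (R : realType) (sigma : R -> R -> R) : Prop :=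
  (forall t : R, 0 <= t -> classK (sigma^~ t)) /\
  (forall s : R, 0 <= s ->
     (forall t1 t2 : R, 0 <= t1 -> t1 <= t2 -> sigma s t2 <= sigma s t1) /\
     sigma s t @[t --> +oo] --> 0).

(* Global existence of the solution is part of the property. *)
Definition UGAS (R : realType) (n : nat) (r : R)
    (f : (R -> 'rV[R]_n) -> 'rV[R]_n) (X : funspace R n) : Prop :=
  exists2 sigma : R -> R -> R, classKL sigma &
    forall x0, fs_mem X x0 -> exists2 x, global_solution r f x0 x &
      forall t : R, 0 <= t ->
        fs_norm X (history x t) <= sigma (fs_norm X x0) t.

(* V(phi(t, x0)) <= exp(-t) V(x0) for all t >= 0, including global existence
   of the solution. *)
Definition decays_along (R : realType) (n : nat) (r : R)
    (f : (R -> 'rV[R]_n) -> 'rV[R]_n) (V : (R -> 'rV[R]_n) -> R)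
    (x0 : R -> 'rV[R]_n) : Prop :=
  exists2 x, global_solution r f x0 x &
    forall t : R, 0 <= t -> V (history x t) <= expR (- t) * V x0.

(* Main.v *)
Require Import Defs.
From mathcomp Require Import all_boot all_order all_algebra.
From mathcomp Require Import all_classical all_reals all_analysis.
From mathcomp Require Import measurable_realfun ess_sup_inf ring lra.
Import Order.TTheory GRing.Theory Num.Theory.
Import numFieldNormedType.Exports.
Local Open Scope classical_set_scope.
Local Open Scope ring_scope.
Set Implicit Arguments.
Unset Strict Implicit.
Unset Printing Implicit Defensive.

(** Given a Lyapunov functional, a1(|x_t|) <= V(x_t) <= exp(-t) a2(|x_0|) along
    every solution, where |.| is the norm of X and x_t is in X because x is
    continuously differentiable after time 0. Inverting a1 gives the KL bound.

    Conversely, let sigma be the KL bound. The candidate sup_t exp(t) |x_t| has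
    the right decay, but nothing makes it finite or Lipschitz. Truncating,
<<
    V_q(x) = sup_(t >= 0) exp(t) max(0, |x_t| - 1 / (q + 1)),
>>
    keeps the decay V_q(x_t) <= exp(-t) V_q(x), and on each ball of X only a
    bounded range of times contributes to V_q, since sigma tends to 0. The flow
    is Lipschitz on bounded sets of X over bounded times, hence so is V_q
    ([weighted_excess_lip]). Then V = sup_q c_q V_q, where the weights c_q are
    chosen by a diagonal argument so that the Lipschitz constants of c_q V_q on
    each ball are bounded in q ([converse_lyapunov]). The term t = 0 bounds V
    from below by sup_q c_q max(0, s - 1 / (q + 1)) at s = |x|, a function of
    class K_infinity, and the Lipschitz estimate against the equilibrium bounds
    V from above.

    That the flow is Lipschitz in X and not only in C^0 is where the spaces
    enter. The difference z of two solutions satisfies |z(t)| <= C |z_0| in the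
    sup norm on bounded times ([delay_growth]); as f is Lipschitz, z' obeys the
    same bound for t > 0. Now z_t is made of a shifted end of z_0, which costs
    at most the norm of z_0 in X, and of a piece that is Lipschitz with constant
    C |z_0|, which belongs to X since the derivatives of Lipschitz functions are
    in every L^p and Lipschitz functions are Hoelder continuous. The record
    [shift_stable] isolates this property, established for the Hoelder spaces in
    [C0a_shift_stable] and for the Sobolev spaces in [W1_shift_stable]. The
    latter works up to null sets, and takes from [measurable_derive1] that the
    derivative of a continuous function is always Borel measurable. *)

(** * The Euclidean norm and the sup norm of a history *)

Section EuclideanNorm.
Context {R : realType} {n : nat}.
Implicit Types u v w : 'rV[R]_n.

Definition dotv u v : R := \sum_(i < n) u 0 i * v 0 i.

Lemma enorm_ge0 v : 0 <= enorm v.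
Proof. exact: sqrtr_ge0. Qed.

Lemma sqr_enorm v : enorm v ^+ 2 = dotv v v.
Proof.
rewrite /enorm /dotv sqr_sqrtr; last by apply: sumr_ge0 => i _; exact: sqr_ge0.
by apply: eq_bigr => i _; rewrite expr2.
Qed.

Lemma dotv_ge0 v : 0 <= dotv v v.
Proof. by rewrite -sqr_enorm sqr_ge0. Qed.

Lemma dotvZr a u v : dotv u (a *: v) = a * dotv u v.
Proof. by rewrite mulr_sumr; apply: eq_bigr => i _; rewrite mxE mulrCA. Qed.

Lemma dotvBr u v w : dotv u (v - w) = dotv u v - dotv u w.
Proof. by rewrite -sumrB; apply: eq_bigr => i _; rewrite !mxE mulrBr. Qed.

Lemma enorm0 : enorm (0 : 'rV[R]_n) = 0.
Proof.
by rewrite /enorm big1 ?sqrtr0// => i _; rewrite mxE expr0n.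
Qed.

Lemma enormN v : enorm (- v) = enorm v.
Proof. by congr Num.sqrt; apply: eq_bigr => i _; rewrite mxE sqrrN. Qed.

Lemma enormB u v : enorm (u - v) = enorm (v - u).
Proof. by rewrite -enormN opprB. Qed.

Lemma enorm_coord v i : `|v 0 i| <= enorm v.
Proof.
rewrite -sqrtr_sqr ler_wsqrtr// (bigD1 i)//= lerDl sumr_ge0// => j _.
exact: sqr_ge0.
Qed.

Lemma mx_norm_le_enorm v : `|v| <= enorm v.
Proof.
rewrite /Num.Def.normr/= mx_normrE; apply: bigmax_le => [|[i j] _ /=].
  exact: enorm_ge0.
by rewrite (ord1 i) enorm_coord.
Qed.

Lemma enorm_le0 v : enorm v <= 0 -> v = 0.
Proof.
move=> v0; apply/rowP => i; rewrite mxE; apply/eqP; rewrite -normr_le0.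
exact: le_trans (enorm_coord _ _) v0.
Qed.

(** Cauchy--Schwarz, from the nonnegativity of
    |(w.w) u - (u.w) w|^2 = (w.w) ((u.u) (w.w) - (u.w)^2). *)
Lemma dotv_le u w : dotv u w <= enorm u * enorm w.
Proof.
have [w0|w0] := eqVneq (enorm w) 0.
  have -> : w = 0 by apply: enorm_le0; rewrite w0.
  by rewrite enorm0 mulr0 /dotv big1// => i _; rewrite mxE mulr0.
have w2 : 0 < dotv w w.
  by rewrite -sqr_enorm exprn_gt0// lt_neqAle eq_sym w0 enorm_ge0.
have : 0 <= dotv w w * (dotv u u * dotv w w - dotv u w ^+ 2).
  have sqE a b : dotv (a *: u - b *: w) (a *: u - b *: w) =
      a ^+ 2 * dotv u u - 2 * a * b * dotv u w + b ^+ 2 * dotv w w.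
    rewrite /dotv !mulr_sumr -sumrB -big_split/=; apply: eq_bigr => i _.
    by rewrite !mxE; ring.
  have := dotv_ge0 (dotv w w *: u - dotv u w *: w).
  rewrite sqE; congr (0 <= _); ring.
rewrite pmulr_rge0// subr_ge0 -!sqr_enorm -exprMn => h.
rewrite (le_trans (ler_norm _))// -ler_sqr ?nnegrE ?mulr_ge0 ?enorm_ge0//.
by rewrite real_normK ?num_real.
Qed.

Lemma enormD u v : enorm (u + v) <= enorm u + enorm v.
Proof.
rewrite -ler_sqr ?nnegrE ?addr_ge0 ?enorm_ge0// sqr_enorm.
have -> : dotv (u + v) (u + v) = dotv u u + 2 * dotv u v + dotv v v.
  rewrite /dotv !mulr_sumr -!big_split/=; apply: eq_bigr => i _.
  by rewrite !mxE; ring.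
by rewrite -!sqr_enorm; have := dotv_le u v; lra.
Qed.

Lemma enorm_le_subD u v : enorm u <= enorm v + enorm (u - v).
Proof. by rewrite -{1}(subrKC v u) enormD. Qed.

Lemma enorm_subr_le u v : enorm (u - v) <= enorm u + enorm v.
Proof. by rewrite -(enormN v) enormD. Qed.

Lemma continuous_dotv w : continuous (dotv w).
Proof.
have -> : dotv w = \sum_(i < n) (fun v : 'rV[R]_n => w 0 i * v 0 i).
  by apply/funext => v; rewrite fct_sumE.
apply: (big_ind (fun f : 'rV[R]_n -> R => continuous f)).
- exact: cst_continuous.
- by move=> f g cf cg x; exact: (continuousD (cf x) (cg x)).
- move=> i _ x.
  apply: (@continuousM _ _ (fun=> w 0 i) (fun v : 'rV[R]_n => v 0 i)).
    exact: cst_continuous.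
  exact: coord_continuous.
Qed.

Lemma continuous_enorm : continuous (@enorm R n).
Proof.
move=> v; apply: (@continuous_comp _ _ _ _ Num.sqrt); last first.
  exact: sqrt_continuous.
have -> : (fun v : 'rV[R]_n => \sum_(i < n) v 0 i ^+ 2) =
    \sum_(i < n) (fun v : 'rV[R]_n => v 0 i ^+ 2).
  by apply/funext => u; rewrite fct_sumE.
move: v; apply: (big_ind (fun f : 'rV[R]_n -> R => continuous f)).
- exact: cst_continuous.
- by move=> f g cf cg x; exact: (continuousD (cf x) (cg x)).
- move=> i _ x; under eq_fun do rewrite expr2.
  apply: (@continuousM _ _ (fun v : 'rV[R]_n => v 0 i)
      (fun v : 'rV[R]_n => v 0 i)); exact: coord_continuous.
Qed.

End EuclideanNorm.

Section MeanValue.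
Context {R : realType} {n : nat}.
Implicit Types z : R -> 'rV[R]_n.

Lemma is_derive_dotv (w : 'rV[R]_n) z (s : R) (d : 'rV[R]_n) :
  is_derive s 1 z d -> is_derive s 1 (dotv w \o z) (dotv w d).
Proof.
move=> [dz zd].
pose g := dotv w \o z.
have h : (fun h : R => h^-1 *: (g (h *: 1 + s) - g s)) @ 0^' --> dotv w d.
  have -> : (fun h : R => h^-1 *: (g (h *: 1 + s) - g s)) =
      dotv w \o (fun h : R => h^-1 *: (z (h *: 1 + s) - z s)).
    by apply/funext => h /=; rewrite dotvZr dotvBr.
  apply: (@continuous_cvg _ _ _ _ _ _ (dotv w)); first exact: continuous_dotv.
  by rewrite -zd; exact: dz.
apply: DeriveDef; last exact/cvg_lim.
by apply/cvg_ex; exists (dotv w d).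
Qed.

(** A derivative is estimated in the Euclidean norm by testing the increment
    against itself, which leaves a scalar mean value theorem. *)
Lemma mean_value_enorm z (a b C : R) : a <= b ->
  {within `[a, b], continuous z} ->
  (forall s, a < s < b -> exists2 d, is_derive s 1 z d & enorm d <= C) ->
  enorm (z b - z a) <= C * (b - a).
Proof.
rewrite le_eqVlt => /predU1P[->|ab] cz dz; first by rewrite !subrr enorm0 mulr0.
set w := z b - z a.
have [w0|w0] := eqVneq (enorm w) 0.
  rewrite w0 mulr_ge0 ?subr_ge0 ?(ltW ab)//.
  have [|d _] := dz ((a + b) / 2); first by rewrite midf_lt// midf_lt.
  exact/le_trans/enorm_ge0.
have wgt0 : 0 < enorm w by rewrite lt_neqAle eq_sym w0 enorm_ge0.
have cwz : {within `[a, b], continuous (dotv w \o z)}.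
  by apply: within_continuous_comp => // x _; exact: continuous_dotv.
have dwz s : s \in `]a, b[ ->
    is_derive s 1 (dotv w \o z) ('D_1 (dotv w \o z) s).
  rewrite in_itv/= => /dz[d zd _].
  by apply: DeriveDef => //; have [] := is_derive_dotv w zd.
have [c cab e] := MVT ab dwz cwz.
have [d zd dC] : exists2 d, is_derive c 1 z d & enorm d <= C.
  by apply: dz; rewrite in_itv/= in cab.
have [_ De] := is_derive_dotv w zd.
rewrite -(ler_pM2l wgt0) -expr2 sqr_enorm {2}/w dotvBr.
move: e => /= ->; rewrite De mulrA ler_wpM2r ?subr_ge0 ?(ltW ab)//.
by rewrite (le_trans (dotv_le _ _))// ler_wpM2l// enorm_ge0.
Qed.

End MeanValue.

Section SupNorm.
Context {R : realType} {n : nat} (r : R).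
Hypothesis r_ge0 : 0 <= r.
Implicit Types x y : R -> 'rV[R]_n.

Lemma in_C0_sub x y : in_C0 r x -> in_C0 r y -> in_C0 r (x - y).
Proof. exact: within_continuousB. Qed.

Lemma in_C0_bounded x : in_C0 r x ->
  has_ubound [set enorm (x s) | s in `[- r, 0]].
Proof.
move=> cx; have cex : {within `[- r, 0], continuous (@enorm R n \o x)}.
  by apply: within_continuous_comp => // u _; exact: continuous_enorm.
have r0 : - r <= 0 by rewrite oppr_le0.
have [c _ hc] := EVT_max r0 cex.
by exists (enorm (x c)) => _ [s /= sr <-]; exact: hc.
Qed.

Lemma supnorm_ge x s : in_C0 r x -> - r <= s <= 0 -> enorm (x s) <= supnorm r x.
Proof.
move=> cx sr; apply: ub_le_sup; first exact: in_C0_bounded.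
by exists s => //=; rewrite in_itv.
Qed.

Lemma supnorm_le x c :
  (forall s, - r <= s <= 0 -> enorm (x s) <= c) -> supnorm r x <= c.
Proof.
move=> h; apply: ge_sup.
  by exists (enorm (x 0)), 0 => //=; rewrite in_itv/= lexx oppr_le0 r_ge0.
by move=> _ [s /= sr <-]; apply: h; rewrite in_itv/= in sr.
Qed.

Lemma eq_supnorm x y : (forall s, - r <= s <= 0 -> x s = y s) ->
  supnorm r x = supnorm r y.
Proof.
move=> xy; congr sup; apply/seteqP; split => _ [s /= sr <-]; exists s => //;
  by rewrite in_itv/= in sr; rewrite xy.
Qed.

Lemma supnorm_ge0 x : in_C0 r x -> 0 <= supnorm r x.
Proof.
move=> cx; apply: le_trans (enorm_ge0 (x 0)) _.
by apply: supnorm_ge => //; rewrite lexx oppr_le0 r_ge0.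
Qed.

Lemma supnorm_le_subD x y : in_C0 r x -> in_C0 r y ->
  supnorm r x <= supnorm r y + supnorm r (x - y).
Proof.
move=> cx cy; apply: supnorm_le => s sr.
apply: le_trans (enorm_le_subD _ (y s)) _; apply: lerD; first exact: supnorm_ge.
by apply: (@supnorm_ge (x - y)) => //; exact: in_C0_sub.
Qed.

Lemma supnorm_subC x y : supnorm r (x - y) = supnorm r (y - x).
Proof.
by congr sup; apply/seteqP; split => _ [s sr <-]; exists s => //;
  rewrite !fctE enormB.
Qed.

Lemma supnorm_dist_le x y : in_C0 r x -> in_C0 r y ->
  `|supnorm r x - supnorm r y| <= supnorm r (x - y).
Proof.
move=> cx cy; rewrite ler_distl lerBlDr supnorm_le_subD// andbT supnorm_subC.
exact: supnorm_le_subD.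
Qed.

Lemma in_C0_eq x y : (forall s, - r <= s <= 0 -> x s = y s) ->
  in_C0 r x -> in_C0 r y.
Proof.
move=> xy; apply: subspace_eq_continuous => s; rewrite inE/= in_itv/=.
exact: xy.
Qed.

Lemma in_C0_cst0 : in_C0 r (cst 0 : R -> 'rV[R]_n).
Proof. by apply: continuous_subspaceT => s; exact: cvg_cst. Qed.

Lemma supnorm_cst0 : supnorm r (cst 0 : R -> 'rV[R]_n) = 0.
Proof.
apply/eqP; rewrite eq_le supnorm_ge0 ?andbT; last exact: in_C0_cst0.
by apply: supnorm_le => s _; rewrite enorm0.
Qed.

End SupNorm.

(** * Solutions of the delay equation *)

Section History.
Context {R : realType} {n : nat}.
Implicit Types x z : R -> 'rV[R]_n.

Lemma within_continuous_reindex (U : topologicalType) (A B : set R)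
    (g : R -> R) (x : R -> U) : continuous g -> (forall s, B s -> A (g s)) ->
  {within A, continuous x} -> {within B, continuous (x \o g)}.
Proof.
move=> cg BA /subspace_continuousP cx; apply/subspace_continuousP => s Bs.
apply: cvg_comp (cx _ (BA _ Bs)) => P; rewrite /within/= => hP.
have h : \forall y \near s, A (g y) -> P (g y) by exact: (cg s _ hP).
by apply: filterS h => y hy By; exact/hy/BA.
Qed.

Lemma history0 x : history x 0 = x.
Proof. by apply/funext => s; rewrite /history add0r. Qed.

Lemma history_add x t s : history (history x t) s = history x (t + s).
Proof. by apply/funext => u; rewrite /history addrA. Qed.

Lemma difference_history x t s :
  (fun h : R => h^-1 *: ((history x t \o shift s) (h *: 1) - history x t s)) =
  (fun h : R => h^-1 *: ((x \o shift (t + s)) (h *: 1) - x (t + s))).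
Proof. by apply/funext => h; rewrite /history/= addrCA. Qed.

Lemma derive1_history x t s : derive1 (history x t) s = derive1 x (t + s).
Proof. by rewrite !derive1E /derive difference_history. Qed.

Lemma derivable_history x t s :
  derivable (history x t) s 1 <-> derivable x (t + s) 1.
Proof. by rewrite /derivable difference_history. Qed.

Lemma is_derive_history x (t s : R) (d : 'rV[R]_n) :
  is_derive (t + s) 1 x d -> is_derive s 1 (history x t) d.
Proof.
move=> [dx xd]; apply: DeriveDef; first exact/derivable_history.
by rewrite -derive1E derive1_history derive1E.
Qed.

Variables (r : R) (r_ge0 : 0 <= r).

Lemma within_history_segment (a b t : R) x : 0 <= t ->
  {within `[a, +oo[, continuous x} ->
  {within `[a, b], continuous (history x t)}.
Proof.
move=> t0; apply: within_continuous_reindex => [s|s /=].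
  by apply: cvgD; [exact: cvg_cst|exact: cvg_id].
by rewrite !in_itv/= andbT => /andP[as_ _]; rewrite (le_trans as_)// lerDr.
Qed.

Lemma in_C0_history t x : 0 <= t ->
  {within `[- r, +oo[, continuous x} -> in_C0 r (history x t).
Proof. exact: within_history_segment. Qed.

Lemma within_history_ray t x : 0 <= t ->
  {within `[- r, +oo[, continuous x} ->
  {within `[- r, +oo[, continuous (history x t)}.
Proof.
move=> t0; apply: within_continuous_reindex => [s|s /=].
  by apply: cvgD; [exact: cvg_cst|exact: cvg_id].
by rewrite !in_itv/= !andbT => rs; rewrite (le_trans rs)// lerDr.
Qed.

Lemma in_C0_within x : {within `[- r, +oo[, continuous x} -> in_C0 r x.
Proof. by rewrite -{2}(history0 x); exact: in_C0_history. Qed.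

Lemma enorm_bounded x (T : R) : - r <= T ->
  {within `[- r, +oo[, continuous x} ->
  exists2 c : R, - r <= c <= T &
    forall s, - r <= s <= T -> enorm (x s) <= enorm (x c).
Proof.
move=> rT cx.
have cex : {within `[- r, T], continuous (@enorm R n \o x)}.
  apply: within_continuous_comp => [u _|]; first exact: continuous_enorm.
  by rewrite -(history0 x); exact: within_history_segment.
have [c cr hc] := EVT_max rT cex; exists c; first by rewrite in_itv/= in cr.
by move=> s sr; apply: hc; rewrite in_itv.
Qed.

(** Over a time step h with L h <= 1/2, the mean value inequality bounds the
    running maximum M of |z| by its previous value plus M / 2, so that each
    step at most doubles M: this replaces Gronwall's lemma. *)
Lemma delay_growth (L T : R) : exists2 C : R, 1 <= C &
  forall z, {within `[- r, +oo[, continuous z} ->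
    (forall s M, 0 < s < T -> (forall u, - r <= u <= s -> enorm (z u) <= M) ->
      exists2 d, is_derive s 1 z d & enorm d <= L * M) ->
    forall s, - r <= s <= T -> enorm (z s) <= C * supnorm r z.
Proof.
pose L' := Num.max L 1; have L'0 : 0 < L' by rewrite lt_max ltr01 orbT.
pose h := (2 * L')^-1; have h0 : 0 < h by rewrite invr_gt0 mulr_gt0.
pose m := (Num.truncn (T / h)).+1.
exists (2 ^+ m); first by rewrite exprn_ege1// ler1n.
move=> z cz dz; have cz0 := in_C0_within cz.
have S0 := supnorm_ge0 r_ge0 cz0; set S := supnorm r z in S0 *.
have step k s : - r <= s <= T -> s <= k%:R * h -> enorm (z s) <= 2 ^+ k * S.
  elim: k s => [|k IH] s /andP[rs sT] sk.
    rewrite mul0r in sk; rewrite expr0 mul1r; apply: supnorm_ge => //.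
    by rewrite rs.
  have [skh|khs] := leP s (k%:R * h).
    rewrite (le_trans (IH s _ skh)) ?rs//.
    by rewrite exprS -mulrA ler_peMl// ?ler1n// mulr_ge0// exprn_ge0.
  have kh0 : 0 <= k%:R * h by rewrite mulr_ge0// ltW.
  have [c /andP[rc cs] hc] := enorm_bounded rs cz.
  have hz : enorm (z s) <= enorm (z c) by apply: hc; rewrite rs lexx.
  apply: le_trans hz _.
  have [ckh|khc] := leP c (k%:R * h).
    rewrite (le_trans (IH c _ ckh)) ?rc ?(le_trans cs)//.
    by rewrite exprS -mulrA ler_peMl// ?ler1n// mulr_ge0// exprn_ge0.
  have mv : enorm (z c - z (k%:R * h)) <= L' * enorm (z c) * (c - k%:R * h).
    apply: mean_value_enorm; first exact: ltW.
      apply: continuous_subspaceW cz => u /=; rewrite !in_itv/= andbT.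
      by case/andP => + _; apply/le_trans/(le_trans _ kh0); rewrite oppr_le0.
    move=> u /andP[ku uc].
    have [|v /andP[rv vu]|d zd dL] := dz u (enorm (z c)).
    - by rewrite (le_lt_trans kh0 ku) (lt_le_trans uc)// (le_trans cs).
    - by apply: hc; rewrite rv (le_trans vu)// ltW// (lt_le_trans uc).
    - exists d => //; rewrite (le_trans dL)// ler_wpM2r ?enorm_ge0//.
      by rewrite le_max lexx.
  have ch : c - k%:R * h <= h.
    by rewrite lerBlDl (le_trans cs)//; rewrite -natr1 mulrDl mul1r in sk.
  have half : L' * enorm (z c) * (c - k%:R * h) <= enorm (z c) / 2.
    have -> : enorm (z c) / 2 = L' * enorm (z c) * h.
      by rewrite /h invfM; field; rewrite lt0r_neq0.
    by rewrite ler_wpM2l// mulr_ge0 ?enorm_ge0// ltW.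
  have zk : enorm (z (k%:R * h)) <= 2 ^+ k * S.
    apply: IH => //; rewrite (le_trans _ kh0) ?oppr_le0//=.
    by rewrite (le_trans (ltW khs)).
  have := lerD zk (le_trans mv half); rewrite exprS -mulrA.
  move/(le_trans (enorm_le_subD (z c) (z (k%:R * h)))).
  by move: (enorm (z c)) (2 ^+ k * S) => a b; lra.
move=> s sr; apply: step => //.
rewrite -ler_pdivrMr// (@le_trans _ _ (T / h))//.
  by apply: ler_wpM2r; [rewrite invr_ge0 ltW|case/andP: sr].
have [T0|T0] := leP 0 (T / h).
  by rewrite ltW// /m; case/andP: (truncn_itv T0).
by rewrite (le_trans (ltW T0)).
Qed.

End History.

Section Solutions.
Context {R : realType} {n : nat} (r : R) (f : (R -> 'rV[R]_n) -> 'rV[R]_n).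
Hypotheses (r_ge0 : 0 <= r) (f0 : f (cst 0) = 0).
Hypothesis f_lip : lipschitz_bounded_C0 r f.
Implicit Types x y : R -> 'rV[R]_n.

Lemma global_solution_continuous x0 x : global_solution r f x0 x ->
  {within `[- r, +oo[, continuous x}.
Proof. by case. Qed.

Lemma global_solution_init x0 x : global_solution r f x0 x ->
  forall s, - r <= s <= 0 -> x s = x0 s.
Proof. by case. Qed.

Lemma global_solution_is_derive x0 x (t : R) :
  global_solution r f x0 x -> 0 < t -> is_derive t 1 x (f (history x t)).
Proof. by case=> _ _ _; apply. Qed.

Lemma global_solution_history x0 x (t : R) : 0 <= t ->
  global_solution r f x0 x -> global_solution r f (history x t) (history x t).
Proof.
move=> t0 [cx _ x0' dx]; split; [exact: within_history_ray|by []| |].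
- rewrite history_add addr0.
  have [<-|t_neq0] := eqVneq 0 t.
    by rewrite history0; rewrite history0 in x0'.
  have tgt0 : 0 < t by rewrite lt_neqAle t_neq0.
  have [+ <-] := dx t tgt0; rewrite /derivable /derive => h.
  have -> : (fun u : R => u^-1 *: (history x t u - history x t 0)) =
      (fun u : R => u^-1 *: ((x \o shift t) (u *: 1) - x t)).
    apply/funext => u; have u1 : u *: (1 : R) = u by exact: mulr1.
    by rewrite /history/= u1 addr0 (addrC t u).
  exact: cvg_dnbhs_at_right h.
- move=> s s0; rewrite history_add; apply: is_derive_history.
  by apply: dx; rewrite ltr_wpDl.
Qed.

Lemma solution_derivative_bound x0 x (T : R) : 0 <= T ->
  global_solution r f x0 x ->
  exists2 C : R, 0 <= C &
    forall s, 0 < s < T -> exists2 d, is_derive s 1 x d & enorm d <= C.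
Proof.
move=> T0 sol; have [L [L0 _ Llip]] := f_lip.
have cx := global_solution_continuous sol.
have rT : - r <= T by rewrite (le_trans _ T0)// oppr_le0.
have [c _ hc] := enorm_bounded rT cx.
exists (L (enorm (x c)) * enorm (x c)).
  by rewrite mulr_ge0 ?L0 ?enorm_ge0.
move=> s /andP[s0 sT]; exists (f (history x s)).
  exact: global_solution_is_derive sol s0.
have sup_s : supnorm r (history x s) <= enorm (x c).
  apply: supnorm_le => // u /andP[ru u0]; apply: hc; apply/andP; split.
    by rewrite (le_trans ru)// lerDr ltW.
  by rewrite (le_trans _ (ltW sT))// gerDl.
have cxs := in_C0_history (ltW s0) cx.
have := Llip _ (enorm_ge0 _) _ _ cxs (@in_C0_cst0 R n r) sup_s.
rewrite f0 subr0 supnorm_cst0// enorm_ge0 => /(_ isT)/le_trans; apply.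
rewrite ler_wpM2l ?L0 ?enorm_ge0//.
rewrite (_ : history x s - cst 0 = history x s)//.
by apply/funext => u; rewrite !fctE subr0.
Qed.

(** The hypotheses bound the solutions along [0, T] instead of their initial
    conditions, because the constant must not depend on the solutions. *)
Lemma solutions_dist (T rho : R) : 0 <= rho -> exists2 C : R, 0 <= C &
  forall x0 y0 x y, global_solution r f x0 x -> global_solution r f y0 y ->
    (forall t, 0 <= t <= T -> supnorm r (history x t) <= rho) ->
    (forall t, 0 <= t <= T -> supnorm r (history y t) <= rho) ->
    (forall s, - r <= s <= T -> enorm ((x - y) s) <= C * supnorm r (x0 - y0)) /\
    (forall s, 0 < s < T -> exists2 d, is_derive s 1 (x - y) d &
       enorm d <= C * supnorm r (x0 - y0)).
Proof.
move=> rho0; have [L [L0 _ Llip]] := f_lip.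
have [C C1 growth] := delay_growth (n := n) r_ge0 (L rho) T.
have C0 : 0 <= C by apply: le_trans C1.
exists (Num.max C (L rho * C)) => [|x0 y0 x y solx soly bx by_].
  by rewrite le_max C0.
have cx := global_solution_continuous solx.
have cy := global_solution_continuous soly.
have cxy : {within `[- r, +oo[, continuous (x - y)}.
  exact: within_continuousB.
have dxy s : 0 < s < T ->
    is_derive s 1 (x - y) (f (history x s) - f (history y s)).
  move=> /andP[s0 _]; have dx := global_solution_is_derive solx s0.
  by have dy := global_solution_is_derive soly s0; exact: is_deriveB.
have fxy s : 0 < s < T -> enorm (f (history x s) - f (history y s)) <=
    L rho * supnorm r (history x s - history y s).
  move=> /andP[s0 sT]; apply: Llip; first exact: rho0.
  - exact: in_C0_history (ltW s0) cx.
  - exact: in_C0_history (ltW s0) cy.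
  - by apply: bx; rewrite !ltW.
  - by apply: by_; rewrite !ltW.
have dM s M : 0 < s < T ->
    (forall u, - r <= u <= s -> enorm ((x - y) u) <= M) ->
    enorm (f (history x s) - f (history y s)) <= L rho * M.
  move=> sT hM; rewrite (le_trans (fxy s sT))// ler_wpM2l ?L0//.
  apply: supnorm_le => // u /andP[ru u0]; apply: hM; case/andP: sT => s0 _.
  by rewrite (le_trans ru)/= ?lerDr ?(ltW s0)// gerDl.
have e0 : supnorm r (x - y) = supnorm r (x0 - y0).
  apply: eq_supnorm => s sr; rewrite !fctE.
  by rewrite (global_solution_init solx)// (global_solution_init soly).
have S0 : 0 <= supnorm r (x0 - y0).
  by rewrite -e0 supnorm_ge0//; exact: in_C0_within.
have gr s : - r <= s <= T -> enorm ((x - y) s) <= C * supnorm r (x0 - y0).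
  rewrite -e0; apply: growth => // u M uT hM.
  by exists (f (history x u) - f (history y u)); [exact: dxy|exact: dM].
split=> s sT; first by rewrite (le_trans (gr s sT))// ler_wpM2r// le_max lexx.
exists (f (history x s) - f (history y s)); first exact: dxy.
rewrite (le_trans (dM s (C * supnorm r (x0 - y0)) sT _))//.
  move=> u /andP[ru us]; apply: gr; rewrite ru (le_trans us)//.
  by case/andP: sT => _ /ltW.
by rewrite mulrA ler_wpM2r// le_max lexx orbT.
Qed.

Lemma global_solution_unique x0 y0 x y :
  global_solution r f x0 x -> global_solution r f y0 y ->
  (forall s, - r <= s <= 0 -> x0 s = y0 s) ->
  forall s, - r <= s -> x s = y s.
Proof.
move=> solx soly xy0 s rs.
have cx := global_solution_continuous solx.
have cy := global_solution_continuous soly.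
have [c _ hc] := enorm_bounded rs cx; have [c' _ hc'] := enorm_bounded rs cy.
pose rho := Num.max (enorm (x c)) (enorm (y c')).
have rho0 : 0 <= rho by rewrite le_max enorm_ge0.
have [C C0 dist] := solutions_dist s rho0.
have [] := dist _ _ _ _ solx soly.
- move=> t /andP[t0 ts]; apply: supnorm_le => // u /andP[ru u0].
  rewrite le_max hc// (le_trans ru) ?lerDr//= (le_trans _ ts)// gerDl//.
- move=> t /andP[t0 ts]; apply: supnorm_le => // u /andP[ru u0].
  rewrite le_max hc' ?orbT// (le_trans ru) ?lerDr//= (le_trans _ ts)// gerDl//.
move=> /(_ s) + _; rewrite rs lexx => /(_ isT).
rewrite (@eq_supnorm _ _ _ _ (cst 0)) ?supnorm_cst0// => [|u ur].
  by rewrite mulr0 => /enorm_le0 /eqP; rewrite subr_eq0 => /eqP.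
by rewrite !fctE xy0 ?subrr.
Qed.

End Solutions.

(** * Comparison functions *)

Section Comparison.
Context {R : realType}.
Implicit Types a b rho : R -> R.

Lemma classK_le rho s t : classK rho -> 0 <= s -> s <= t -> rho s <= rho t.
Proof.
case=> _ lt_rho _ s0; rewrite le_eqVlt => /predU1P[->//|].
by move/(lt_rho _ _ s0)/ltW.
Qed.

Lemma classK_ge0 rho s : classK rho -> 0 <= s -> 0 <= rho s.
Proof. by move=> Krho s0; case: (Krho) => _ _ {1}<-; exact: classK_le. Qed.

Lemma continuous_within_itvy rho : continuous rho ->
  {within `[0, +oo[, continuous rho}.
Proof. exact: continuous_subspaceT. Qed.

(** The value of b is a choice of preimage, which the intermediate value
    theorem provides; a monotone function onto an interval is continuous. *)
Lemma classKinf_inverse a : classKinf a ->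
  exists2 b, classK b & forall s, 0 <= s -> b (a s) = s.
Proof.
move=> [Ka ainf]; have [ca a_lt a0] := Ka.
have pre y : exists s, 0 <= y -> 0 <= s /\ a s = y.
  have [y0|y0] := leP 0 y; last by exists 0.
  have [S [S0 yS]] : exists S, 0 <= S /\ y <= a S.
    have /cvgryPge/(_ y) h := ainf.
    near +oo_R => S; exists S; split; first by near: S; exact: nbhs_pinfty_ge.
    by near: S.
  have cS : {within `[0, S], continuous a}.
    by apply: continuous_subspaceW ca => u /=; rewrite !in_itv/= => /andP[->].
  have [|s sS <-] := @IVT _ a 0 S y S0 cS.
    by rewrite a0 ge_min y0/= le_max yS orbT.
  by exists s => _; split=> //; move: sS; rewrite in_itv/= => /andP[].
have [b bP] := choice pre.
have b_ge0 y : 0 <= y -> 0 <= b y by move=> /bP[].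
have aK y : 0 <= y -> a (b y) = y by move=> /bP[].
have a_mono s t : 0 <= s -> 0 <= t -> (a s < a t) = (s < t).
  move=> s0 t0; apply/idP/idP; last exact: a_lt.
  by apply: contraLR; rewrite -!leNgt; exact: classK_le.
have bK s : 0 <= s -> b (a s) = s.
  move=> s0; have as0 : 0 <= a s by exact: classK_ge0.
  have := a_mono (b (a s)) s (b_ge0 _ as0) s0.
  have := a_mono s (b (a s)) s0 (b_ge0 _ as0).
  by rewrite aK// ltxx; case: ltgtP.
exists b; last by [].
split=> [|y z y0 yz|].
- apply/subspace_continuousP => y /=; rewrite in_itv/= andbT => y0.
  apply/cvgrPdist_lt => e e0; rewrite near_withinE.
  have up : \forall z \near y, z < a (b y + e).
    apply: lt_nbhsl; rewrite -{1}(aK y y0) a_lt ?b_ge0//.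
    by rewrite ltrDl.
  have lo : \forall z \near y, 0 <= z -> b y - e < b z.
    have [be|be] := ltP (b y - e) 0.
      by near=> z => z0; rewrite (lt_le_trans be)// b_ge0.
    have : \forall z \near y, a (b y - e) < z.
      apply: lt_nbhsr; rewrite -{2}(aK y y0) a_lt//.
      by rewrite ltrBlDr ltrDl.
    apply: filterS => z az z0.
    by rewrite -a_mono ?b_ge0// aK.
  near=> z => /=; rewrite in_itv/= andbT => z0.
  rewrite ltr_distlC; apply/andP; split.
    have : 0 <= z -> b y - e < b z by near: z; exact: lo.
    exact.
  rewrite -a_mono ?b_ge0 ?aK ?addr_ge0 ?b_ge0 ?(ltW e0)//.
  by near: z.
- by rewrite -a_mono ?b_ge0 ?aK ?(le_trans y0 (ltW yz)).
- by rewrite -a0 bK.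
Unshelve. all: by end_near. Qed.

Lemma classKL_expR b a2 : classK b -> classK a2 ->
  classKL (fun s t => b (expR (- t) * a2 s)).
Proof.
move=> Kb Ka; have [cb b_lt b0] := Kb; have [ca a_lt a0] := Ka.
split=> [t t0|s s0]; first split.
- apply/subspace_continuousP => s /=; rewrite in_itv/= andbT => s0.
  move/subspace_continuousP : ca => /(_ s).
  rewrite /= in_itv/= s0 => /(_ isT) ca.
  have ys0 : 0 <= expR (- t) * a2 s by rewrite mulr_ge0 ?expR_ge0 ?classK_ge0.
  move/subspace_continuousP : cb => /(_ (expR (- t) * a2 s)).
  rewrite /= in_itv/= ys0 => /(_ isT) cb.
  have cm : expR (- t) * a2 u @[u --> within `[0, +oo[ (nbhs s)]
      --> expR (- t) * a2 s by apply: cvgM => //; exact: cvg_cst.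
  move=> P /cb; rewrite nbhs_filterE /within/= => hP.
  have h1 : \forall u \near within `[0, +oo[ (nbhs s),
      0 <= expR (- t) * a2 u -> P (b (expR (- t) * a2 u)).
    have : \forall u \near within `[0, +oo[ (nbhs s),
      expR (- t) * a2 u \in `[0, +oo[ -> P (b (expR (- t) * a2 u)) := cm _ hP.
    by apply: filterS => u h y0; apply: h; rewrite in_itv/= y0.
  have h2 : \forall u \near within `[0, +oo[ (nbhs s), 0 <= u.
    by rewrite near_withinE; apply: nearW => u /=; rewrite in_itv/= andbT.
  suff : \forall u \near within `[0, +oo[ (nbhs s), P (b (expR (- t) * a2 u)).
    by [].
  apply: filterS2 h1 h2 => u + u0; apply.
  by rewrite mulr_ge0 ?expR_ge0 ?classK_ge0.
- move=> u v u0 uv; apply: b_lt.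
    by rewrite mulr_ge0 ?expR_ge0 ?classK_ge0.
  by rewrite ltr_pM2l ?expR_gt0// a_lt.
- by rewrite a0 mulr0.
have as0 : 0 <= a2 s by exact: classK_ge0.
split=> [t1 t2 t10 t12|].
  apply: classK_le => //; first by rewrite mulr_ge0 ?expR_ge0.
  by rewrite ler_wpM2r// ler_expR lerN2.
move/subspace_continuousP : cb => /(_ 0); rewrite /= in_itv/= lexx.
move=> /(_ isT) cb.
have ct : expR (- t) * a2 s @[t --> +oo] --> 0.
  by rewrite -(mul0r (a2 s)); apply: cvgM; [exact: cvgr_expR|exact: cvg_cst].
rewrite -b0 => P /cb; rewrite nbhs_filterE /within/= => hP.
have : \forall u \near +oo, expR (- u) * a2 s \in `[0, +oo[ ->
  P (b (expR (- u) * a2 s)) := ct _ hP.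
suff : \forall u \near +oo, expR (- u) * a2 s \in `[0, +oo[.
  by move=> h1 h2; apply: filterS2 h1 h2 => u h; exact.
by apply: nearW => u; rewrite in_itv/= andbT mulr_ge0 ?expR_ge0.
Qed.

(** The majorant is s times 1 plus a sum of hinge functions, the k-th of which
    is at least g (k + 1) from s = k on. Near any given point the sum over
    k < truncn s + 2 equals a sum over a fixed range, because the hinge
    functions of larger index vanish there. *)
Lemma classKinf_majorant (g : nat -> R) : (forall k, 0 <= g k) ->
  exists2 a, classKinf a &
    forall s, 0 <= s -> g (Num.truncn s).+1 * s <= a s.
Proof.
move=> g0.
pose F K (s : R) := \sum_(k < K) g k.+1 * Num.max 0 (s - k%:R + 1).
pose a s := s * (1 + F (Num.truncn s).+2 s).
have F_ge0 K s : 0 <= F K s.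
  by apply: sumr_ge0 => k _; rewrite mulr_ge0// le_max lexx.
have F_stable K s : s < K.+1%:R -> F (Num.truncn s).+2 s = F K.+2 s.
  rewrite -truncn_le_nat => sK; have sS := truncnS_gt s.
  have truncK : ((Num.truncn s).+2 <= K.+2)%N by rewrite !ltnS.
  rewrite /F -(subnKC truncK) big_split_ord/= -[LHS]addr0; congr (_ + _).
  apply/esym/big1 => k _; rewrite max_l ?mulr0//.
  have k0 : 0 <= k%:R :> R by [].
  by rewrite !addSn -2!natr1 natrD; rewrite -natr1 in sS; lra.
have F_mono K s t : s <= t -> F K s <= F K t.
  move=> st; apply: ler_sum => k _; rewrite ler_wpM2l//.
  by rewrite ge_max le_max lexx/= le_max lerD2r lerD2r st orbT.
have cF K : continuous (F K).
  have -> : F K = \sum_(k < K) (fun s => g k.+1 * Num.max 0 (s - k%:R + 1)).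
    by apply/funext => s; rewrite fct_sumE.
  apply: (big_ind (fun h : R -> R => continuous h)).
  - exact: cst_continuous.
  - by move=> h1 h2 c1 c2 x; exact: (continuousD (c1 x) (c2 x)).
  - move=> k _ x.
    have cmax : {for x, continuous (fun s : R => Num.max 0 (s - k%:R + 1))}.
      apply: (@continuous_max _ _ (fun=> 0) (fun s : R => s - k%:R + 1)).
        exact: cst_continuous.
      apply: continuousD; last exact: cst_continuous.
      by apply: continuousB; [exact: cvg_id|exact: cst_continuous].
    have ccst : {for x, continuous (fun=> g k.+1 : R)} by exact: cst_continuous.
    by have := continuousM ccst cmax; exact.
have a_ge s : 0 <= s -> s <= a s.
  by move=> s0; rewrite ler_peMr// lerDl.
exists a; last first.
  move=> s s0; rewrite /a mulrC ler_wpM2l//.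
  have /andP[ts _] := truncn_itv s0.
  have -> : F (Num.truncn s).+2 s = F (Num.truncn s).+1 s +
      g (Num.truncn s).+2 * Num.max 0 (s - (Num.truncn s).+1%:R + 1).
    by rewrite /F big_ord_recr.
  have h : g (Num.truncn s).+1 <= F (Num.truncn s).+1 s.
    rewrite /F big_ord_recr/= ler_wpDl//; first exact: F_ge0.
    by rewrite ler_peMr// le_max; apply/orP; right; lra.
  have : 0 <= g (Num.truncn s).+2 * Num.max 0 (s - (Num.truncn s).+1%:R + 1).
    by rewrite mulr_ge0// le_max lexx.
  lra.
split; first split.
- apply: continuous_within_itvy => s.
  pose K := Num.truncn s; have sK : s < K.+1%:R by exact: truncnS_gt.
  have aE : \forall u \near s, u * (1 + F K.+2 u) = a u.
    by near=> u; rewrite /a (F_stable K)//; near: u; exact: lt_nbhsl.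
  apply: cvg_trans; first by apply: near_eq_cvg; exact: aE.
  apply: cvgM; first exact: cvg_id.
  by apply: cvgD; [exact: cvg_cst|exact: cF].
- move=> s t s0 st.
  have t0 : 0 < t by rewrite (le_lt_trans s0).
  rewrite /a (F_stable (Num.truncn t) s) ?(lt_trans st (truncnS_gt t))//.
  apply: (@le_lt_trans _ _ (s * (1 + F (Num.truncn t).+2 t))).
    by rewrite ler_wpM2l// lerD2l F_mono// ltW.
  by rewrite ltr_pM2r// ltr_wpDr.
- by rewrite /a mul0r.
apply: ger_cvgy; last exact: cvg_id.
by near=> s; apply: a_ge; near: s; exact: nbhs_pinfty_ge.
Unshelve. all: by end_near. Qed.

End Comparison.

(** * A Lyapunov functional from a uniform decay estimate *)

Section ConverseLyapunov.
Context {R : realType} {T : Type}.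
Variables (N : T -> R) (d : T -> T -> R) (mem : T -> Prop) (phi : R -> T -> T)
  (sigma : R -> R -> R) (z0 : T).
Hypothesis N_ge0 : forall x, mem x -> 0 <= N x.
Hypothesis d_ge0 : forall x y, mem x -> mem y -> 0 <= d x y.
Hypothesis phi0 : forall x, mem x -> N (phi 0 x) = N x.
Hypothesis phi_add : forall x s t, mem x -> 0 <= s -> 0 <= t ->
  N (phi s (phi t x)) = N (phi (t + s) x).
Hypothesis KL_sigma : classKL sigma.
Hypothesis phi_sigma : forall x t, mem x -> 0 <= t ->
  N (phi t x) <= sigma (N x) t.
Hypothesis phi_lip : forall (S : R) (k : nat), exists2 B : R, 0 <= B &
  forall x y, mem x -> mem y -> N x <= k%:R -> N y <= k%:R ->
    forall t, 0 <= t <= S -> `|N (phi t x) - N (phi t y)| <= B * d x y.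
Hypothesis mem_z0 : mem z0.
Hypothesis N_z0 : N z0 = 0.
Hypothesis d_z0 : forall x, mem x -> d x z0 = N x.

Definition excess (q : nat) (s : R) : R := Num.max 0 (s - q.+1%:R^-1).

Lemma excess_ge0 q s : 0 <= excess q s.
Proof. by rewrite le_max lexx. Qed.

Lemma excess_eq0 q s : s <= q.+1%:R^-1 -> excess q s = 0.
Proof. by move=> sq; apply: max_l; rewrite subr_le0. Qed.

Lemma excess_lip q s t : `|excess q s - excess q t| <= `|s - t|.
Proof.
wlog ts : s t / t <= s => [hw|].
  have [/hw//|/ltW/hw] := leP t s.
  by rewrite distrC (distrC s).
have le_ts : excess q t <= excess q s.
  by rewrite ge_max le_max lexx/= le_max lerD2r ts orbT.
rewrite !ger0_norm ?subr_ge0// lerBlDr ge_max; apply/andP; split.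
  by rewrite addr_ge0 ?subr_ge0 ?excess_ge0.
have : t - q.+1%:R^-1 <= excess q t by rewrite le_max lexx orbT.
by move: (excess q t) (q.+1%:R^-1) => g h; lra.
Qed.

(** The orbits from a ball enter the ball of radius 1 / (q + 1) after a common
    time, beyond which the q-th functional vanishes; only finitely long pieces
    of orbit matter, and along these the flow is Lipschitz. *)
Lemma weighted_excess_lip (q k : nat) : exists2 B : R, 0 <= B &
  forall x y, mem x -> mem y -> N x <= k%:R -> N y <= k%:R ->
    forall t, 0 <= t ->
    `|expR t * excess q (N (phi t x)) - expR t * excess q (N (phi t y))|
      <= B * d x y.
Proof.
have [Ksig /(_ k%:R)[//|_ sig0]] := KL_sigma.
have [S hS] : exists S : R, forall t, S <= t -> sigma k%:R t <= q.+1%:R^-1.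
  have q0 : 0 < q.+1%:R^-1 :> R by rewrite invr_gt0.
  move/cvgrPdist_le : sig0 => /(_ _ q0) [M [_ hM]]; exists (M + 1) => t Mt.
  have := hM t; rewrite sub0r normrN => /(_ _)/ler_normlW; apply.
  by rewrite (lt_le_trans _ Mt)// ltrDl.
have [B B0 lipB] := phi_lip S k.
exists (expR S * B) => [|x y mx my xk yk t t0].
  by rewrite mulr_ge0 ?expR_ge0.
have small z : S <= t -> mem z -> N z <= k%:R -> excess q (N (phi t z)) = 0.
  move=> St mz zk; apply: excess_eq0.
  rewrite (le_trans (phi_sigma mz t0))// (le_trans _ (hS t St))//.
  by apply: (@classK_le _ (sigma^~ t)) => //; [exact: Ksig|exact: N_ge0].
have [St|tS] := leP S t.
  by rewrite !small// mulr0 subrr normr0 !mulr_ge0 ?expR_ge0 ?d_ge0.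
rewrite -mulrBr normrM ger0_norm ?expR_ge0// -mulrA ler_pM ?expR_ge0//.
  by rewrite ler_expR ltW.
by rewrite (le_trans (excess_lip _ _ _))// lipB// t0 ltW.
Qed.

(** V x is the supremum over q and t >= 0 of
    c_q exp(t) max(0, N (phi t x) - 1 / (q + 1)). Moving x along the flow shifts
    t, whence the decay; t = 0 gives the lower bound; the upper bound follows
    from the Lipschitz estimate between x and z0. *)
Lemma converse_lyapunov : exists (V : T -> R) (a1 a2 : R -> R),
  [/\ forall x, mem x -> 0 <= V x,
      forall rho : R, 0 <= rho -> exists2 M : R, 0 <= M &
        forall x y, mem x -> mem y -> N x <= rho -> N y <= rho ->
          `|V x - V y| <= M * d x y,
      classKinf a1, classKinf a2 &
      forall x, mem x -> a1 (N x) <= V x <= a2 (N x) /\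
        forall t, 0 <= t -> V (phi t x) <= expR (- t) * V x].
Proof.
have [B hB] := choice (fun qk : nat * nat =>
  let: ex_intro2 B B0 h := weighted_excess_lip qk.1 qk.2 in
  ex_intro (fun B => 0 <= B /\ _) B (conj B0 h)).
have B0 q k : 0 <= B (q, k) by have [] := hB (q, k).
have lipB q k := (hB (q, k)).2.
(* The diagonal weights make the Lipschitz constants on each ball bounded
   uniformly in q: all but finitely many of them are at most 1. *)
pose c q : R := (1 + \sum_(k < q.+1) B (q, k : nat))^-1.
pose C k : R := 1 + \sum_(q < k) B (q : nat, k).
have c0 q : 0 < c q.
  by rewrite invr_gt0 ltr_wpDr// sumr_ge0.
have c1 q : c q <= 1.
  by rewrite invf_le1 ?lerDl ?sumr_ge0// ltr_wpDr// sumr_ge0.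
have C0 k : 0 <= C k by rewrite addr_ge0// sumr_ge0.
have cBC q k : c q * B (q, k) <= C k.
  have [qk|kq] := ltnP q k.
    rewrite (@le_trans _ _ (B (q, k)))//; first by rewrite ler_piMl.
    rewrite /C (bigD1 (Ordinal qk))//= addrCA lerDl addr_ge0// sumr_ge0//.
  rewrite (@le_trans _ _ 1)//; last by rewrite lerDl sumr_ge0.
  rewrite mulrC ler_pdivrMr ?mul1r ?ltr_wpDr ?sumr_ge0//.
  have kq' : (k < q.+1)%N by rewrite ltnS.
  by rewrite (bigD1 (Ordinal kq'))//= addrCA lerDl addr_ge0// sumr_ge0.
pose val x (q : nat) t := c q * (expR t * excess q (N (phi t x))).
pose W x := [set v | exists (q : nat) (t : R), 0 <= t /\ v = val x q t].
pose V x := sup (W x).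
have val_dist k x y q t : mem x -> mem y -> N x <= k%:R -> N y <= k%:R ->
    0 <= t -> `|val x q t - val y q t| <= C k * d x y.
  move=> mx my xk yk t0; rewrite -mulrBr normrM (gtr0_norm (c0 q)).
  rewrite (@le_trans _ _ (c q * (B (q, k) * d x y)))//.
    by rewrite ler_wpM2l ?(ltW (c0 q))// lipB.
  by rewrite mulrA ler_wpM2r// d_ge0.
have val_z0 q t : 0 <= t -> val z0 q t = 0.
  move=> t0; rewrite /val excess_eq0 ?mulr0//.
  have [Ksig _] := KL_sigma; have [_ _ sig0] := Ksig t t0.
  by rewrite (le_trans (phi_sigma mem_z0 t0))// N_z0 sig0 invr_ge0.
have W_le k x v : mem x -> N x <= k%:R -> W x v -> v <= C k * N x.
  move=> mx xk [q [t [t0 ->]]].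
  have := val_dist k x z0 q t mx mem_z0 xk; rewrite N_z0 val_z0// subr0 d_z0//.
  by move=> /(_ (ler0n _ _) t0); exact: le_trans (ler_norm _).
have W_neq0 x : W x !=set0 by exists (val x 0%N 0), 0%N, 0.
have N_nat x : N x <= (Num.truncn (N x)).+1%:R by exact/ltW/truncnS_gt.
have hsW x : mem x -> has_sup (W x).
  move=> mx; split=> //; exists (C (Num.truncn (N x)).+1 * N x) => v.
  exact: W_le.
have val_V x q t : mem x -> 0 <= t -> val x q t <= V x.
  by move=> mx t0; apply: ub_le_sup; [case: (hsW x mx)|exists q, t].
have val_ge0 x q t : 0 <= val x q t.
  by rewrite !mulr_ge0 ?expR_ge0 ?excess_ge0 ?(ltW (c0 q)).
pose A s := [set v | exists q : nat, v = c q * excess q s].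
pose a1 s := sup (A s).
have A_neq0 s : A s !=set0 by exists (c 0%N * excess 0 s), 0%N.
have A_ub s : has_ubound (A s).
  exists `|s| => _ [q ->]; rewrite (@le_trans _ _ (excess q s))//.
    by rewrite ler_piMl// excess_ge0.
  by rewrite ge_max normr_ge0/= (le_trans _ (ler_norm s))// gerBl invr_ge0.
have A_a1 s q : c q * excess q s <= a1 s by apply: ub_le_sup => //; exists q.
have a1_ge0 s : 0 <= a1 s.
  by rewrite (le_trans _ (A_a1 s 0%N))// mulr_ge0 ?excess_ge0// ltW.
have a1_lip s t : a1 s <= a1 t + `|s - t|.
  apply: ge_sup => // _ [q ->].
  rewrite -lerBlDl (le_trans (lerB (lexx _) (A_a1 t q)))// -mulrBr.
  rewrite (le_trans (ler_norm _))// normrM gtr0_norm//.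
  rewrite (le_trans _ (excess_lip q s t))//.
  by rewrite ler_piMl.
have a1_0 : a1 0 = 0.
  apply/eqP; rewrite eq_le a1_ge0 andbT; apply: ge_sup => // _ [q ->].
  by rewrite excess_eq0 ?mulr0// invr_ge0.
have a1_gt0 s : 0 < s -> 0 < a1 s.
  move=> s0; pose q := Num.truncn s^-1.
  rewrite (lt_le_trans _ (A_a1 s q))// mulr_gt0// lt_max subr_gt0.
  by rewrite invf_plt ?posrE// truncnS_gt orbT.
have [a2 Ka2 a2P] := classKinf_majorant C0.
exists V, a1, a2; split=> //.
- by move=> x mx; rewrite (le_trans (val_ge0 x 0%N 0))// val_V.
- move=> rho rho0; pose k := (Num.truncn rho).+1.
  have rk : rho <= k%:R by exact/ltW/truncnS_gt.
  exists (C k) => // x y mx my xr yr.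
  have xk := le_trans xr rk; have yk := le_trans yr rk.
  have val_le q t : 0 <= t ->
      val x q t <= V y + C k * d x y /\ val y q t <= V x + C k * d x y.
    move=> t0; have := val_dist k x y q t mx my xk yk t0.
    have := val_V x q t mx t0; have := val_V y q t my t0.
    by rewrite ler_distl => ? ? /andP[? ?]; lra.
  rewrite ler_distl lerBlDr; apply/andP.
  by split; apply: ge_sup => // v [q [t [t0 ->]]]; have [] := val_le q t t0.
- split; first split=> //.
  + apply: continuous_within_itvy => s; apply/cvgrPdist_le => e e0.
    move: (@cvg_id _ (nbhs s)) => /cvgrPdist_le/(_ _ e0).
    apply: filterS => t; apply: le_trans.
    have := a1_lip s t; have := a1_lip t s.
    by rewrite (distrC t) ler_norml; lra.
  (* (s - h) / s increases with s, whence a1 s / s is nondecreasing. *)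
  + move=> s t s0 st; have t0 : 0 < t by rewrite (le_lt_trans s0).
    apply: (@le_lt_trans _ _ (s / t * a1 t)); last first.
      by rewrite gtr_pMl ?a1_gt0// ltr_pdivrMr// mul1r.
    apply: ge_sup => // _ [q ->].
    rewrite (@le_trans _ _ (s / t * (c q * excess q t)))//; last first.
      by rewrite ler_wpM2l// divr_ge0// ltW.
    rewrite mulrCA ler_wpM2l ?(ltW (c0 q))// ge_max.
    rewrite mulr_ge0 ?excess_ge0 ?divr_ge0 ?(ltW t0)//=.
    rewrite (@le_trans _ _ (s / t * (t - q.+1%:R^-1)))//; last first.
      by rewrite ler_wpM2l ?divr_ge0 ?(ltW t0)// le_max lexx orbT.
    rewrite mulrBr divfK ?lt0r_neq0// lerB// ler_piMl ?invr_ge0//.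
    by rewrite ler_pdivrMr// mul1r ltW.
  + apply: (@ger_cvgy _ _ _ _ (fun s => c 0%N * (s - 1))).
      near=> s; rewrite (le_trans _ (A_a1 s 0%N))// ler_wpM2l ?(ltW (c0 _))//.
      by rewrite le_max invr1 lexx orbT.
    apply/cvgryPge => K; near=> s.
    rewrite mulrC -ler_pdivrMr// lerBrDr.
    by near: s; apply: nbhs_pinfty_ge; exact: num_real.
- move=> x mx; split.
    apply/andP; split.
      apply: ge_sup => // _ [q ->].
      have := val_V x q 0 mx (lexx _).
      by rewrite /val expR0 mul1r phi0.
    rewrite (le_trans _ (a2P _ (N_ge0 mx)))//; apply: ge_sup => // v.
    exact: W_le.
  move=> t t0; apply: ge_sup => // _ [q [s [s0 ->]]].
  have -> : val (phi t x) q s = expR (- t) * val x q (t + s).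
    rewrite /val phi_add// expRD expRN.
    by field; rewrite lt0r_neq0// expR_gt0.
  by rewrite ler_wpM2l ?expR_ge0// val_V// addr_ge0.
Unshelve. all: by end_near. Qed.

End ConverseLyapunov.

(** * Shifts, Lebesgue norms and measurability of derivatives *)

Section LnormLebesgue.
Context {R : realType}.
Local Notation mu := (@lebesgue_measure R).
Implicit Types g h : R -> R.

Lemma measurable_shift (t : R) : measurable_fun [set: R] (fun s : R => t + s).
Proof. by apply: measurable_funD => //; exact: measurable_cst. Qed.

Lemma lebesgue_measure_shift (t : R) (A : set R) : measurable A ->
  mu ((fun s => t + s) @^-1` A) = mu A.
Proof.
move=> mA.
pose nu : {measure set (measurableTypeR R) -> \bar R} :=
  pushforward mu (fun s : measurableTypeR R => t + s : measurableTypeR R).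
rewrite -[LHS]/(nu (measurable_shift t) A); apply/esym.
apply: lebesgue_measure_unique => // _ [[a b] _ <-] /=.
rewrite /nu/= /pushforward.
have -> : (fun s => t + s) @^-1` `]a, b] = `]a - t, b - t]%classic.
  by apply/seteqP; split=> s /=; rewrite !in_itv/= ltrBlDl lerBrDl.
rewrite !lebesgue_measure_itv/= !lte_fin ltrD2r.
by case: ifPn => // _; rewrite -!EFinB; congr EFin; ring.
Qed.

Lemma ae_shift (t : R) (P : R -> Prop) : {ae mu, forall s, P s} ->
  {ae mu, forall s, P (t + s)}.
Proof.
move=> [N [mN N0 PN]]; exists ((fun s => t + s) @^-1` N); split.
- by rewrite -[X in measurable X]setTI; exact: measurable_shift.
- by rewrite lebesgue_measure_shift.
- by move=> s nP; exact: PN.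
Qed.

Lemma ae_imply (P Q : R -> Prop) : (forall s, P s -> Q s) ->
  {ae mu, forall s, P s} -> {ae mu, forall s, Q s}.
Proof.
by move=> PQ [N [mN N0 PN]]; exists N; split=> // s nQ; apply: PN => /PQ.
Qed.

Lemma ae_and (P Q : R -> Prop) : {ae mu, forall s, P s} ->
  {ae mu, forall s, Q s} -> {ae mu, forall s, P s /\ Q s}.
Proof.
move=> [N [mN N0 PN]] [M [mM M0 QM]]; exists (N `|` M); split.
- exact: measurableU.
- by rewrite measureU0.
- move=> s /= nPQ; have [Ps|nPs] := pselect (P s); last by left; exact: PN.
  by right; apply: QM => /= Qs; exact: nPQ.
Qed.

Lemma ae_neq (a : R) : {ae mu, forall s, s != a}.
Proof.
exists [set a]; split=> //; first exact: lebesgue_measure_set1.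
by move=> s /= /negP; rewrite negbK => /eqP.
Qed.

Lemma Lnorm_shift_le (t : R) (p : \bar R) g : (1 <= p)%E ->
  measurable_fun [set: R] g ->
  ('N[mu]_p[EFin \o (g \o (fun s : R => (t + s)%R))] <= 'N[mu]_p[EFin \o g])%E.
Proof.
case: p => // [q|] p1 mg.
  have mgq : measurable_fun [set: R] (fun s => (`|(g s)%:E| `^ q)%E).
    apply: (measurableT_comp (measurable_poweR q)).
    exact/measurableT_comp/measurable_EFinP.
  have eqI : (\int[mu]_s (`|(g (t + s)%R)%:E| `^ q) =
      \int[mu]_s (`|(g s)%:E| `^ q))%E.
    have := @ge0_integral_pushforward _ _ (measurableTypeR R)
      (measurableTypeR R) R (fun s => t + s) (measurable_shift t) mu setT _
      measurableT mgq.
    rewrite preimage_setT => <-; last by move=> s _; exact: poweR_ge0.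
    apply: eq_measure_integral => [|? A mA _]; first exact: measurable_shift.
    exact: lebesgue_measure_shift.
  by rewrite unlock /= eqI.
rewrite unlock; case: ifPn => // _; apply/ess_supP.
have : {ae mu, forall s, (abse \o (EFin \o g)) s <=
    ess_sup mu (abse \o (EFin \o g))}%E by exact: ess_sup_ge.
exact: ae_shift.
Qed.

Lemma Lnorm_ae_le (p : \bar R) g h : (1 <= p)%E ->
  measurable_fun [set: R] g -> measurable_fun [set: R] h ->
  {ae mu, forall s, `|g s| <= `|h s|} ->
  ('N[mu]_p[EFin \o g] <= 'N[mu]_p[EFin \o h])%E.
Proof.
case: p => // [q|] p1 mg mh gh.
  have q0 : 0 <= q by rewrite (le_trans ler01)// -lee_fin.
  have mq (k : R -> R) : measurable_fun [set: R] k ->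
      measurable_fun [set: R] (fun s => (`|(k s)%:E| `^ q)%E).
    move=> mk; apply: (measurableT_comp (measurable_poweR q)).
    exact/measurableT_comp/measurable_EFinP.
  rewrite unlock; apply: gt0_ler_poweR; first by rewrite invr_ge0.
  - by rewrite in_itv/= leey andbT integral_ge0// => s _; exact: poweR_ge0.
  - by rewrite in_itv/= leey andbT integral_ge0// => s _; exact: poweR_ge0.
  apply: ae_ge0_le_integral => //; try by move=> s _; exact: poweR_ge0.
  - exact: mq.
  - exact: mq.
  apply: ae_imply gh => s gh _; rewrite !abse_EFin !poweR_EFin lee_fin.
  by apply: ge0_ler_powR; rewrite ?nnegrE.
rewrite unlock; case: ifPn => // _; apply: le_ess_sup.
by apply: ae_imply gh => s; rewrite /= lee_fin.
Qed.

(** Minkowski's inequality in the form used for derivatives, which add up and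
    shift only almost everywhere. *)
Lemma Lnorm_ae_le_add (p : \bar R) g h1 h2 : (1 <= p)%E ->
  measurable_fun [set: R] g -> measurable_fun [set: R] h1 ->
  measurable_fun [set: R] h2 ->
  {ae mu, forall s, `|g s| <= `|h1 s + h2 s|} ->
  ('N[mu]_p[EFin \o g] <= 'N[mu]_p[EFin \o h1] + 'N[mu]_p[EFin \o h2])%E.
Proof.
move=> p1 mg mh1 mh2 gh.
apply: (@le_trans _ _ ('N[mu]_p[EFin \o (h1 \+ h2)%R])%E); last first.
  exact: eminkowski.
by apply: Lnorm_ae_le => //; exact: measurable_funD.
Qed.

Lemma Lnorm_cst_itv_le (p : \bar R) (a b : R) : (1 <= p)%E ->
  exists2 kappa : R, 0 <= kappa & forall c : R, 0 <= c ->
    ('N[mu]_p[EFin \o (cst c \_ `]a, b[)] <= (kappa * c)%:E)%E.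
Proof.
case: p => // [q|] p1.
  have q0 : 0 < q by rewrite (lt_le_trans ltr01)// -lee_fin.
  pose M : R := if a < b then b - a else 0.
  have M0 : 0 <= M by rewrite /M; case: ifPn => // /ltW; rewrite subr_ge0.
  exists (M `^ q^-1) => [|c c0]; first exact: powR_ge0.
  rewrite unlock.
  have -> : (fun s => `|(EFin \o (cst c \_ `]a, b[)) s| `^ q)%E =
      (cst (c `^ q)%:E \_ `]a, b[).
    apply/funext => s; rewrite /= !patchE; case: ifP => _.
      by rewrite ger0_norm.
    by rewrite normr0 powR0// lt0r_neq0.
  rewrite -integral_mkcond integral_cst//= lebesgue_measure_itv/= lte_fin.
  have -> : (if (a < b)%R then b%:E - a%:E else 0)%E = M%:E.
    by rewrite /M; case: ifPn.
  rewrite -EFinM poweR_EFin lee_fin powRM ?powR_ge0// -powRrM.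
  by rewrite mulfV ?lt0r_neq0// powRr1// mulrC.
exists 1 => // c c0; rewrite unlock; case: ifPn => _; last first.
  by rewrite mul1r lee_fin.
apply/ess_supP/nearW => s /=; rewrite lee_fin mul1r patchE.
by case: ifP => _; rewrite ?normr0// ger0_norm.
Qed.

End LnormLebesgue.

Section DerivativeMeasurable.
Context {R : realType} {n : nat}.
Implicit Types y : R -> 'rV[R]_n.

Let slope y (s h : R) := h^-1 *: (y (h *: 1 + s) - y s).

Let continuous_slope y h : continuous y -> continuous (slope y ^~ h).
Proof.
move=> cy s.
have cs : {for s, continuous (fun u : R => h *: 1 + u)}.
  by apply: continuousD; [exact: cst_continuous|exact: cvg_id].
have cys : {for s, continuous (fun u : R => y (h *: 1 + u))}.
  exact: (continuous_comp cs (cy _)).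
by have cB := continuousB cys (cy s); apply: cvgZl_tmp; exact: cB.
Qed.

(** Differentiability at s says that the difference quotients form a Cauchy
    filter. For fixed precision and fixed range of increments this is an
    intersection of closed conditions on s, over uncountably many increments
    but closed nevertheless. *)
Lemma measurable_derivable y : continuous y ->
  measurable [set s : R | derivable y s 1].
Proof.
move=> cy.
pose F (k m : nat) := [set s : R | forall h h', 0 < `|h| < m.+1%:R^-1 ->
  0 < `|h'| < m.+1%:R^-1 -> `|slope y s h - slope y s h'| <= k.+1%:R^-1].
have closedF k m : closed (F k m).
  have -> : F k m = \bigcap_(hh in [set hh : R * R |
      0 < `|hh.1| < m.+1%:R^-1 /\ 0 < `|hh.2| < m.+1%:R^-1])
      [set s : R | `|slope y s hh.1 - slope y s hh.2| <= k.+1%:R^-1].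
    apply/seteqP; split => [s Fs [h h'] [/= h0 h'0]|s Fs h h' h0 h'0].
      exact: Fs.
    exact: (Fs (h, h')).
  apply: closed_bigI => -[h h'] _ /=.
  have cd : continuous (fun s => `|slope y s h - slope y s h'|).
    move=> s; apply: cvg_norm; apply: cvgB; exact: continuous_slope.
  have /continuous_closedP/(_ _ (@closed_le R (k.+1%:R^-1))) := cd.
  exact.
suff -> : [set s : R | derivable y s 1] = \bigcap_k \bigcup_m F k m.
  apply: bigcap_measurable => // k _; apply: bigcup_measurable => m _.
  by apply: closed_measurable; exact: closedF.
apply/seteqP; split => [s /cvg_ex[l dl] k _|s Fs].
  have k0 : 0 < k.+1%:R^-1 / 2 :> R by rewrite divr_gt0 ?invr_gt0.
  move/cvgrPdist_le : dl => /(_ _ k0).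
  rewrite /dnbhs near_withinE => -[e /= e0 he].
  exists (Num.truncn e^-1) => // h h' /andP[h0 hm] /andP[h'0 h'm].
  have me : (Num.truncn e^-1).+1%:R^-1 <= e.
    by rewrite invf_ple ?posrE// ltW// truncnS_gt.
  have q u : 0 < `|u| -> `|u| < (Num.truncn e^-1).+1%:R^-1 ->
      `|l - slope y s u| <= k.+1%:R^-1 / 2.
    move=> u0 um; apply: (he u); last by rewrite -normr_gt0.
    by rewrite /= sub0r normrN (lt_le_trans um).
  rewrite -(subrKA l) (le_trans (ler_normD _ _))//.
  by rewrite [leRHS]splitr lerD ?q// distrC q.
apply/cauchy_cvgP/cauchy_ballP => e e0.
have [m _ Fm] := Fs (Num.truncn e^-1) I.
have ke : (Num.truncn e^-1).+1%:R^-1 < e.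
  by rewrite invf_plt ?posrE// truncnS_gt.
pose A := [set h : R | 0 < `|h| < m.+1%:R^-1].
have hA : \forall h \near 0^', A h.
  have m0 : 0 < m.+1%:R^-1 :> R by rewrite invr_gt0.
  near=> h; apply/andP; split; last by near: h; exact: dnbhs0_lt.
  by rewrite normr_gt0; near: h; exact: nbhs_dnbhs_neq.
exists (slope y s @` A, slope y s @` A) => /=.
  by split; apply: filterS hA => h Ah; exists h.
move=> [u v] [/= [h Ah <-] [h' Ah' <-]].
by rewrite -ball_normE /ball_/= (le_lt_trans (Fm _ _ Ah Ah')).
Unshelve. all: by end_near. Qed.

(** On the measurable set of points of differentiability [derive1] is a limit
    of difference quotients; on its complement it is a constant default value,
    so that not even a null set of points has to be discarded. *)
Lemma measurable_derive1 y (i : 'I_n) : continuous y ->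
  measurable_fun [set: R] (fun s => derive1 y s 0 i).
Proof.
move=> cy; set D := [set s : R | derivable y s 1].
have mD : measurable D by exact: measurable_derivable.
rewrite -(setUv D); apply/measurable_funU => //; first exact: measurableC.
split.
  pose u (m : nat) (s : R) := slope y s m.+1%:R^-1 0 i.
  apply: (@measurable_fun_cvg _ _ _ _ u) => [m|s Ds].
    apply: (@measurable_funS _ _ _ _ setT) => //.
    apply: continuous_measurable_fun => s.
    apply: (@continuous_comp _ _ _ (slope y ^~ m.+1%:R^-1)
      (fun v : 'rV[R]_n => v 0 i)); first exact: continuous_slope.
    exact: coord_continuous.
  have h0 : (m.+1%:R^-1 : R) @[m --> \oo] --> 0^'.
    move=> P; rewrite /dnbhs /within/= => hP.
    have hP' : nbhs (0 : R) (fun h => h != 0 -> P h) := hP.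
    have : \forall m \near \oo, (m.+1%:R^-1 : R) != 0 -> P m.+1%:R^-1.
      exact: (@cvg_harmonic R _ hP').
    by apply: filterS => m; apply; rewrite invr_neq0.
  rewrite derive1E.
  apply: (@continuous_cvg _ _ _ _ _ _ (fun v : 'rV[R]_n => v 0 i)).
    exact: coord_continuous.
  exact: cvg_comp h0 Ds.
apply: (@eq_measurable_fun _ _ _ _ _ (cst ((point : 'rV[R]_n) 0 i))) => //.
by move=> s; rewrite inE /= => nD; rewrite derive1E /derive dvgP.
Qed.

End DerivativeMeasurable.

(** * Function spaces stable along the flow *)

Section ShiftStable.
Context {R : realType} {n : nat}.
Implicit Types x y z : R -> 'rV[R]_n.

(** What the equivalence needs to know about the space. The last property
    contains the regularity of solutions, applied to one solution, and the
    Lipschitz dependence on the initial condition, applied to the difference of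
    two solutions. *)
Record shift_stable (r : R) (X : funspace R n) : Prop := ShiftStable {
  stable_C0 : forall x, fs_mem X x -> in_C0 r x;
  stable_supnorm_le : forall x, fs_mem X x -> supnorm r x <= fs_norm X x;
  stable_sub : forall x y, fs_mem X x -> fs_mem X y -> fs_mem X (x - y);
  stable_norm_lip : forall x y, fs_mem X x -> fs_mem X y ->
    `|fs_norm X x - fs_norm X y| <= fs_norm X (x - y);
  stable_eq : forall x y, (forall s, - r <= s <= 0 -> x s = y s) ->
    fs_mem X x -> fs_mem X y /\ fs_norm X x = fs_norm X y;
  stable_cst0 : fs_mem X (cst 0);
  stable_norm0 : fs_norm X (cst 0) = 0;
  stable_history : exists2 kappa : R, 0 <= kappa &
    forall z (C t : R), 0 <= C -> 0 <= t ->
      {within `[- r, +oo[, continuous z} ->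
      fs_mem X z ->
      (forall s, 0 < s < t -> exists2 d, is_derive s 1 z d & enorm d <= C) ->
      fs_mem X (history z t) /\
      fs_norm X (history z t) <=
        supnorm r (history z t) + fs_norm X z + kappa * C }.

(** An interval of the time axis is cut at 0: before, only the values of the
    initial piece count; after, the bound on the derivative does. Written with
    min and max, the estimate needs no case distinction on the endpoints. *)
Lemma enorm_increment_split (r t C : R) z (a b : R) : 0 <= r ->
  0 <= t -> 0 <= C -> {within `[- r, +oo[, continuous z} ->
  (forall s, 0 < s < t -> exists2 d, is_derive s 1 z d & enorm d <= C) ->
  a <= b -> b <= t ->
  enorm (z b - z a) <=
    enorm (z (Num.min b 0) - z (Num.min a 0)) + C * (b - a).
Proof.
move=> r0 t0 C0 cz dz ab bt.
have -> : z b - z a = (z (Num.min b 0) - z (Num.min a 0)) +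
    (z (Num.max b 0) - z (Num.max a 0)).
  have sum0 c : z (Num.min c 0) + z (Num.max c 0) = z c + z 0.
    by have [c0|c0] := ltP c 0; [|rewrite addrC].
  by rewrite addrACA -opprD !sum0 opprD addrACA subrr addr0.
rewrite (le_trans (enormD _ _))// lerD2l.
have amb : Num.max a 0 <= Num.max b 0.
  by rewrite ge_max le_max ab/= le_max lexx orbT.
rewrite (@le_trans _ _ (C * (Num.max b 0 - Num.max a 0)))//.
  apply: mean_value_enorm => //.
    apply: continuous_subspaceW cz => u /=; rewrite !in_itv/= andbT.
    case/andP => au _; rewrite (@le_trans _ _ 0) ?oppr_le0//.
    by rewrite (le_trans _ au)// le_max lexx orbT.
  move=> s /andP[as_ sb]; apply: dz; apply/andP; split.
    by rewrite (le_lt_trans _ as_)// le_max lexx orbT.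
  by rewrite (lt_le_trans sb)// ge_max bt.
rewrite ler_wpM2l//.
by have [a0|a0] := ltP a 0; have [b0|b0] := ltP b 0; lra.
Qed.

End ShiftStable.

Section HoelderSpace.
Context {R : realType} {n : nat}.
Variables (r alpha : R).
Hypotheses (r_gt0 : 0 < r) (alpha_ge0 : 0 <= alpha) (alpha_le1 : alpha <= 1).
Implicit Types x y z : R -> 'rV[R]_n.

Local Notation Q := (@hoelder_quotients R n r alpha).
Let r_ge0 : 0 <= r. Proof. exact: ltW. Qed.

Lemma hoelder_quotients_neq0 x : Q x !=set0.
Proof.
exists (enorm (x 0 - x (- r)) / (`|0 - - r| `^ alpha)), 0, (- r).
by rewrite !in_itv/= !lexx oppr_le0 r_ge0 eq_sym oppr_eq0 gt_eqF.
Qed.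

Lemma hoelder_sup_ge0 x : has_ubound (Q x) -> 0 <= sup (Q x).
Proof.
move=> ub; have [q Qq] := hoelder_quotients_neq0 x.
rewrite (le_trans _ (ub_le_sup ub Qq))//.
by case: Qq => t [s [_ _ _ ->]]; rewrite divr_ge0 ?enorm_ge0 ?powR_ge0.
Qed.

Lemma hoelder_le x : has_ubound (Q x) -> forall t s, - r <= t <= 0 ->
  - r <= s <= 0 -> enorm (x t - x s) <= sup (Q x) * `|t - s| `^ alpha.
Proof.
move=> ub t s tr sr; have [->|ts] := eqVneq t s.
  by rewrite !subrr enorm0 mulr_ge0 ?powR_ge0// hoelder_sup_ge0.
rewrite -ler_pdivrMr ?powR_gt0 ?normr_gt0 ?subr_eq0//.
by apply: ub_le_sup => //; exists t, s; rewrite !in_itv.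
Qed.

Lemma hoelder_sup_le x (c : R) :
  (forall t s, - r <= t <= 0 -> - r <= s <= 0 ->
    enorm (x t - x s) <= c * `|t - s| `^ alpha) ->
  has_ubound (Q x) /\ sup (Q x) <= c.
Proof.
move=> h; have ub : ubound (Q x) c.
  move=> q [t [s [tr sr ts ->]]]; rewrite !in_itv/= in tr sr.
  by rewrite ler_pdivrMr ?h// powR_gt0// normr_gt0 subr_eq0.
by split; [exists c|apply: ge_sup => //; exact: hoelder_quotients_neq0].
Qed.

Let hoelder_cst0 : has_ubound (Q (cst 0)) /\ sup (Q (cst 0)) <= 0.
Proof.
by apply: hoelder_sup_le => t s _ _; rewrite subrr enorm0 mul0r.
Qed.

Let hoelder_subD x y : has_ubound (Q x) -> has_ubound (Q y) ->
  has_ubound (Q (x - y)) /\ sup (Q (x - y)) <= sup (Q x) + sup (Q y).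
Proof.
move=> ux uy; apply: hoelder_sup_le => t s tr sr; rewrite !fctE mulrDl.
have -> : x t - y t - (x s - y s) = (x t - x s) - (y t - y s).
  by apply/rowP => i; rewrite !mxE; ring.
by rewrite (le_trans (enorm_subr_le _ _))// lerD ?hoelder_le.
Qed.

Let hoelder_le_subD x y : has_ubound (Q x) -> has_ubound (Q y) ->
  sup (Q x) <= sup (Q y) + sup (Q (x - y)).
Proof.
move=> ux uy; have [uxy _] := hoelder_subD ux uy.
apply: (proj2 (@hoelder_sup_le x _ _)) => t s tr sr; rewrite mulrDl.
apply: le_trans (enorm_le_subD _ (y t - y s)) _.
apply: lerD; first exact: hoelder_le.
have -> : x t - x s - (y t - y s) = (x - y) t - (x - y) s.
  by apply/rowP => i; rewrite !fctE !mxE; ring.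
exact: hoelder_le.
Qed.

Let hoelder_subC x y : Q (x - y) = Q (y - x).
Proof.
have e t s : enorm ((x - y) t - (x - y) s) = enorm ((y - x) t - (y - x) s).
  rewrite -enormN; congr enorm; apply/rowP => i; rewrite !fctE !mxE; ring.
by apply/seteqP; split => q [t [s [tr sr ts ->]]]; exists t, s; split=> //;
  rewrite e.
Qed.

(** On an interval of length at most r, a function with derivative at most C is
    Hoelder continuous with constant r^(1 - alpha) C. *)
Lemma C0a_shift_stable : shift_stable r (C0a n r alpha).
Proof.
have norm_le x y : fs_mem (C0a n r alpha) x -> fs_mem (C0a n r alpha) y ->
    fs_norm (C0a n r alpha) x <=
    fs_norm (C0a n r alpha) y + fs_norm (C0a n r alpha) (x - y).
  move=> [cx ux] [cy uy] /=; rewrite ge_max; apply/andP; split.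
    by rewrite (le_trans (supnorm_le_subD r_ge0 cx cy))// lerD// le_max lexx.
  by rewrite (le_trans (hoelder_le_subD ux uy))// lerD// le_max lexx orbT.
split=> [x []//|x _ /=|x y [cx ux] [cy uy]|x y mx my|x y xy [cx ux]|||].
- by rewrite le_max lexx.
- by split; [exact: in_C0_sub|have [] := hoelder_subD ux uy].
- rewrite ler_distl lerBlDr norm_le// andbT.
  have -> : fs_norm (C0a n r alpha) (x - y) = fs_norm (C0a n r alpha) (y - x).
    by rewrite /= hoelder_subC supnorm_subC.
  exact: norm_le.
- have eQ : Q x = Q y.
    apply/seteqP; split => q [t [s [tr sr ts ->]]]; exists t, s; split=> //;
      by rewrite !in_itv/= in tr sr; rewrite !xy.
  split; first by split; [exact: in_C0_eq cx|rewrite -eQ].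
  by rewrite /= eQ (eq_supnorm xy).
- split; first exact: in_C0_cst0.
  exact: proj1 hoelder_cst0.
- rewrite /= supnorm_cst0//; apply: max_l.
  exact: proj2 hoelder_cst0.
exists (r `^ (1 - alpha)) => [|z C t C0 t0 cz [cz0 uz] dz].
  exact: powR_ge0.
have cht := in_C0_history t0 cz.
have kC : 0 <= r `^ (1 - alpha) * C by rewrite mulr_ge0 ?powR_ge0.
have [uh hh] : has_ubound (Q (history z t)) /\
    sup (Q (history z t)) <= sup (Q z) + r `^ (1 - alpha) * C.
  apply: hoelder_sup_le => b a; wlog ab : a b / a <= b => [hw br ar|].
    have [ab|/ltW ba] := leP a b; first exact: hw.
    by rewrite enormB distrC hw.
  move=> /andP[rb b0] /andP[ra a0]; rewrite mulrDl.
  have [->|neq_ab] := eqVneq b a.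
    rewrite !subrr enorm0 -mulrDl mulr_ge0 ?powR_ge0//.
    by rewrite addr_ge0 ?hoelder_sup_ge0.
  have ltab : a < b by rewrite lt_neqAle eq_sym neq_ab.
  have := @enorm_increment_split _ _ r t C z (t + a) (t + b) r_ge0 t0 C0 cz dz.
  rewrite lerD2l gerDl => /(_ ab b0)/le_trans; apply; apply: lerD.
    set u := Num.min (t + b) 0; set v := Num.min (t + a) 0.
    have vu : v <= u by rewrite le_min ge_min lerD2l ab/= ge_min lexx orbT.
    have rv : - r <= v.
      by rewrite le_min oppr_le0 r_ge0 andbT (le_trans ra)// lerDr.
    have u0 : u <= 0 by rewrite ge_min lexx orbT.
    rewrite (le_trans (hoelder_le uz _ _))//.
    - by rewrite (le_trans rv).
    - by rewrite rv (le_trans vu).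
    apply: ler_wpM2l; first exact: hoelder_sup_ge0.
    apply: ge0_ler_powR; rewrite ?nnegrE//.
    rewrite !ger0_norm ?subr_ge0// /u /v.
    by have [b0'|b0'] := ltP (t + b) 0; have [a0'|a0'] := ltP (t + a) 0; lra.
  rewrite opprD addrACA subrr add0r.
  have -> : r `^ (1 - alpha) * C * `|b - a| `^ alpha =
      C * (r `^ (1 - alpha) * `|b - a| `^ alpha) by ring.
  rewrite ler_wpM2l// ger0_norm ?subr_ge0//.
  have {1}-> : b - a = (b - a) `^ (1 - alpha) * (b - a) `^ alpha.
    rewrite -powRD ?subrK ?powRr1 ?subr_ge0//.
    by rewrite oner_eq0.
  rewrite ler_wpM2r ?powR_ge0//.
  apply: ge0_ler_powR; rewrite ?nnegrE ?subr_ge0//.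
  lra.
split; first by [].
rewrite /= ge_max; apply/andP; split.
  rewrite -addrA lerDl addr_ge0// le_max; apply/orP; left; exact: supnorm_ge0.
rewrite (le_trans hh)// lerD2r -[leLHS]add0r lerD ?supnorm_ge0//.
by rewrite le_max lexx orbT.
Qed.

End HoelderSpace.

(** * The Sobolev space *)

Section AbsContinuous.
Context {R : realType} {n : nat}.
Implicit Types x y z : R -> 'rV[R]_n.

Lemma abs_continuous_eq (a b : R) x y :
  (forall s, a <= s <= b -> x s = y s) ->
  abs_continuous a b x -> abs_continuous a b y.
Proof.
move=> xy acx e /acx[del del0 h]; exists del => // m u v uv disj lt.
rewrite (le_lt_trans _ (h m u v uv disj lt))//; apply: ler_sum => k _.
by have [au ukv vb] := uv k; rewrite !xy// ?au ?vb ?andbT/=; lra.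
Qed.

Lemma abs_continuous_sub (a b : R) x y :
  abs_continuous a b x -> abs_continuous a b y -> abs_continuous a b (x - y).
Proof.
move=> acx acy e e0; have e20 : 0 < e / 2 by rewrite divr_gt0.
have [d1 d10 h1] := acx _ e20; have [d2 d20 h2] := acy _ e20.
exists (Num.min d1 d2) => [|m u v uv disj]; first by rewrite lt_min d10.
rewrite lt_min => /andP[lt1 lt2]; rewrite (splitr e).
apply: le_lt_trans (ltrD (h1 m u v uv disj lt1) (h2 m u v uv disj lt2)).
rewrite -big_split/=; apply: ler_sum => k _.
have -> : (x - y) (v k) - (x - y) (u k) =
    (x (v k) - x (u k)) - (y (v k) - y (u k)).
  by apply/rowP => i; rewrite !fctE !mxE; ring.
exact: enorm_subr_le.
Qed.

Lemma abs_continuous_cst0 (a b : R) :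
  abs_continuous a b (cst 0 : R -> 'rV[R]_n).
Proof.
move=> e e0; exists 1 => // m u v _ _ _.
by rewrite big1// => k _; rewrite subrr enorm0.
Qed.

Lemma abs_continuous_in_C0 (r : R) x : abs_continuous (- r) 0 x -> in_C0 r x.
Proof.
move=> acx; apply/subspace_continuousP => s /=.
rewrite in_itv/= => /andP[rs s0].
apply/cvgrPdist_lt => e e0; have [d d0 h] := acx e e0.
rewrite near_withinE.
have /cvgrPdist_lt/(_ _ d0) := @cvg_id _ (nbhs s).
apply: filterS => u su; rewrite /= in_itv/= => /andP[ru u0].
rewrite (le_lt_trans (mx_norm_le_enorm _))//.
have hd a b : - r <= a -> a <= b -> b <= 0 -> b - a < d ->
    enorm (x b - x a) < e.
  move=> ra ab b0 lt; have := h 1%N (fun=> a) (fun=> b).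
  rewrite !big_ord_recl !big_ord0 !addr0; apply=> // k l.
  by rewrite !ord1 eqxx.
have [us|/ltW us] := leP u s.
  by apply: hd => //; rewrite (le_lt_trans _ su)// ler_norm.
rewrite enormB; apply: hd => //.
by rewrite (le_lt_trans _ su)// distrC ler_norm.
Qed.

(** The part of the intervals before time 0 is controlled by the absolute
    continuity of the initial piece, the part after it by the bound on z'. *)
Lemma abs_continuous_history (r t C : R) z : 0 <= r -> 0 <= t -> 0 <= C ->
  {within `[- r, +oo[, continuous z} ->
  (forall s, 0 < s < t -> exists2 d, is_derive s 1 z d & enorm d <= C) ->
  abs_continuous (- r) 0 z -> abs_continuous (- r) 0 (history z t).
Proof.
move=> r0 t0 C0 cz dz acz e e0; have e20 : 0 < e / 2 by rewrite divr_gt0.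
have [d d0 h] := acz _ e20.
have C1 : 0 < 2 * (C + 1) by rewrite mulr_gt0// ltr_wpDl.
exists (Num.min d (e / (2 * (C + 1)))) => [|m u v uv disj].
  by rewrite lt_min d0 divr_gt0.
rewrite lt_min => /andP[ltd lte].
pose cut c := Num.min (t + c) 0.
have cut_le a b : a <= b -> cut a <= cut b.
  by move=> ab; rewrite le_min ge_min lerD2l ab/= ge_min lexx orbT.
have cut_sub a b : a <= b -> cut b - cut a <= b - a.
  by move=> ab; rewrite /cut; have [b0|b0] := ltP (t + b) 0;
    have [a0|a0] := ltP (t + a) 0; lra.
have first_part : \sum_(k < m) enorm (z (cut (v k)) - z (cut (u k))) < e / 2.
  apply: h => [k|k l kl|].
  - have [ru ukv v0] := uv k.
    split; [|exact: cut_le|by rewrite ge_min lexx orbT].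
    by rewrite le_min oppr_le0 r0 andbT (le_trans ru)// lerDr.
  - by have [?|?] := disj k l kl; [left|right]; exact: cut_le.
  - rewrite (le_lt_trans _ ltd)//; apply: ler_sum => k _.
    by have [_ ukv _] := uv k; exact: cut_sub.
have second_part : C * \sum_(k < m) (v k - u k) <= e / 2.
  have S0 : 0 <= \sum_(k < m) (v k - u k).
    by apply: sumr_ge0 => k _; have [_ ukv _] := uv k; rewrite subr_ge0.
  rewrite (@le_trans _ _ ((C + 1) * \sum_(k < m) (v k - u k)))//.
    by rewrite ler_wpM2r// lerDl.
  rewrite mulrC -ler_pdivlMr ?ltr_wpDl// (le_trans (ltW lte))//.
  by rewrite invfM mulrA.
rewrite (splitr e); apply: le_lt_trans (ltr_leD first_part second_part).
rewrite mulr_sumr -big_split/=; apply: ler_sum => k _.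
have [ru ukv v0] := uv k.
have := @enorm_increment_split _ _ r t C z (t + u k) (t + v k) r0 t0 C0 cz dz.
rewrite lerD2l gerDl => /(_ ukv v0)/le_trans; apply; rewrite lerD2l.
by rewrite opprD addrACA subrr add0r.
Qed.

End AbsContinuous.

Lemma fine_le_add (R : realType) (a b : \bar R) (c : R) :
  a \is a fin_num -> b \is a fin_num -> (a <= b + c%:E)%E ->
  fine a <= fine b + c.
Proof. by case: a => // a _; case: b => // b _; rewrite -EFinD lee_fin. Qed.

Lemma fine_dist_le (R : realType) (a b c : \bar R) :
  a \is a fin_num -> b \is a fin_num -> c \is a fin_num ->
  (a <= b + c)%E -> (b <= a + c)%E -> `|fine a - fine b| <= fine c.
Proof.
case: a => // a _; case: b => // b _; case: c => // c _.
by rewrite -!EFinD !lee_fin ler_distl lerBlDr => -> ->.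
Qed.

Section SobolevSpace.
Context {R : realType} {n : nat}.
Variables (r : R) (p : \bar R).
Hypotheses (r_gt0 : 0 < r) (p_ge1 : (1 <= p)%E).
Implicit Types x y z : R -> 'rV[R]_n.

Local Notation mu := (@lebesgue_measure R).
Let r_ge0 : 0 <= r. Proof. exact: ltW. Qed.

Let speed x : R -> R := (fun s => enorm (derive1 x s)) \_ `]- r, 0[%classic.

Let LnormE x : Lnorm_derivative r p x = ('N[mu]_p[EFin \o speed x])%E.
Proof. by []. Qed.

Let speed_ge0 x s : 0 <= speed x s.
Proof. by rewrite /speed patchE; case: ifP => // _; exact: enorm_ge0. Qed.

Let speedE x s : s \in `]- r, 0[ -> speed x s = enorm (derive1 x s).
Proof. by move=> sr; rewrite /speed patchE mem_set. Qed.

Let speed_out x s : s \notin `]- r, 0[ -> speed x s = 0.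
Proof. by move=> sr; rewrite /speed patchE memNset//; exact/negP. Qed.

Let near_itv (s : R) : s \in `]- r, 0[ -> \forall u \near s, u \in `]- r, 0[.
Proof.
rewrite in_itv/= => /andP[rs s0]; near=> u; rewrite in_itv/=; apply/andP; split.
  by near: u; exact: lt_nbhsr.
by near: u; exact: lt_nbhsl.
Unshelve. all: by end_near. Qed.

Let near_eq_itv x y (s : R) : (forall s, - r <= s <= 0 -> x s = y s) ->
  s \in `]- r, 0[ -> \forall u \near s, x u = y u.
Proof.
move=> xy /near_itv; apply: filterS => u; rewrite in_itv/= => /andP[ru u0].
by apply: xy; rewrite !ltW.
Qed.

Lemma eq_derive1_itv x y (s : R) : (forall s, - r <= s <= 0 -> x s = y s) ->
  s \in `]- r, 0[ -> derive1 x s = derive1 y s.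
Proof.
move=> xy sr; rewrite !derive1E.
by apply: near_eq_derive; exact: near_eq_itv sr.
Qed.

Let eq_speed x y : (forall s, - r <= s <= 0 -> x s = y s) -> speed x = speed y.
Proof.
move=> xy; apply/funext => s.
have [sr|sr] := boolP (s \in `]- r, 0[); last by rewrite !speed_out.
by rewrite (speedE x sr) (speedE y sr) (eq_derive1_itv xy sr).
Qed.

(** The derivative only depends on the restriction to [-r, 0], which extends
    to a continuous function on the line, constant outside of [-r, 0]. *)
Lemma measurable_derive1_in_C0 x (i : 'I_n) : in_C0 r x ->
  measurable_fun `]- r, 0[ (fun s => derive1 x s 0 i).
Proof.
move=> cx; pose clamp (s : R) : R := Num.max (- r) (Num.min s 0).
have cclamp : continuous clamp.
  move=> s; apply: (@continuous_max _ _ (fun=> - r) (fun s : R => Num.min s 0)).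
    exact: cst_continuous.
  apply: (@continuous_min _ _ (fun s : R => s) (fun=> 0)); first exact: cvg_id.
  exact: cst_continuous.
have clamp_itv s : `[- r, 0]%classic (clamp s).
  by rewrite /= in_itv/= le_max lexx/= ge_max oppr_le0 r_ge0 ge_min lexx orbT.
have cy : continuous (x \o clamp).
  have : {within [set: R], continuous (x \o clamp)}.
    exact: (within_continuous_reindex cclamp (fun s _ => clamp_itv s) cx).
  move=> /subspace_continuousP cy s; have := cy s I.
  by rewrite withinET.
have xy s : - r <= s <= 0 -> x s = (x \o clamp) s.
  by move=> /andP[rs s0]; rewrite /= /clamp (min_l s0) max_r.
apply: (@eq_measurable_fun _ _ _ _ _ (fun s => derive1 (x \o clamp) s 0 i)).
  by move=> s; rewrite inE/= => sr; rewrite (eq_derive1_itv xy sr).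
apply: (@measurable_funS _ _ _ _ setT) => //.
exact: measurable_derive1.
Qed.

Let measurable_speed x : in_C0 r x -> measurable_fun [set: R] (speed x).
Proof.
move=> cx; apply/measurable_restrict => //; rewrite setTI.
apply: (@measurableT_comp _ _ _ _ _ _ (Num.sqrt : R -> R)).
  by apply: continuous_measurable_fun => s; exact: sqrt_continuous.
apply: measurable_sum => i; apply: measurable_funX.
exact: measurable_derive1_in_C0.
Qed.

Let in_W1I x : abs_continuous (- r) 0 x ->
  {ae mu, forall s : R, s \in `]- r, 0[ -> derivable x s 1} ->
  (Lnorm_derivative r p x < +oo)%E -> in_W1 r p x.
Proof.
move=> acx dx Lx; split=> // i.
by apply: measurable_derive1_in_C0; exact: abs_continuous_in_C0.
Qed.

Let in_W1_C0 x : in_W1 r p x -> in_C0 r x.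
Proof. by case=> acx _ _ _; exact: abs_continuous_in_C0. Qed.

Let Lnorm_fin_num x : in_W1 r p x -> Lnorm_derivative r p x \is a fin_num.
Proof.
by case=> _ _ _ Lx; rewrite ge0_fin_numE// LnormE; exact: Lnorm_ge0.
Qed.

Let speed_le_add x y z : in_C0 r x -> in_C0 r y -> in_C0 r z ->
  {ae mu, forall s, s \in `]- r, 0[ ->
     enorm (derive1 x s) <= enorm (derive1 y s) + enorm (derive1 z s)} ->
  (Lnorm_derivative r p x <= Lnorm_derivative r p y + Lnorm_derivative r p z)%E.
Proof.
move=> cx cy cz xyz; rewrite !LnormE; apply: Lnorm_ae_le_add => //;
  try exact: measurable_speed.
apply: ae_imply xyz => s h; rewrite !ger0_norm ?addr_ge0//.
have [sr|sr] := boolP (s \in `]- r, 0[).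
  by rewrite !(speedE _ sr); exact: (h sr).
by rewrite !speed_out// addr0.
Qed.

Let ae_derive1_sub x y : in_W1 r p x -> in_W1 r p y ->
  {ae mu, forall s, s \in `]- r, 0[ -> derivable (x - y) s 1 /\
     derive1 (x - y) s = derive1 x s - derive1 y s}.
Proof.
move=> [_ dx _ _] [_ dy _ _]; apply: ae_imply (ae_and dx dy) => s [hx hy] sr.
split; first exact: derivableB (hx sr) (hy sr).
by rewrite !derive1E deriveB; [|exact: hx|exact: hy].
Qed.

Let W1_sub x y : in_W1 r p x -> in_W1 r p y ->
  in_W1 r p (x - y).
Proof.
move=> wx wy; have dxy := ae_derive1_sub wx wy.
have cx := in_W1_C0 wx; have cy := in_W1_C0 wy.
have [acx _ _ Lx] := wx; have [acy _ _ Ly] := wy.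
apply: in_W1I; first exact: abs_continuous_sub.
  by apply: ae_imply dxy => s h /h[].
apply: (@le_lt_trans _ _ (Lnorm_derivative r p x + Lnorm_derivative r p y)%E).
  apply: speed_le_add => //; first exact: in_C0_sub.
  by apply: ae_imply dxy => s h /h[_ ->]; exact: enorm_subr_le.
exact: (lte_add_pinfty Lx Ly).
Qed.

Let W1_Lnorm_lip x y : in_W1 r p x -> in_W1 r p y ->
  `|fine (Lnorm_derivative r p x) - fine (Lnorm_derivative r p y)| <=
    fine (Lnorm_derivative r p (x - y)).
Proof.
move=> wx wy; have wxy := W1_sub wx wy; have dxy := ae_derive1_sub wx wy.
have cx := in_W1_C0 wx; have cy := in_W1_C0 wy; have cxy := in_W1_C0 wxy.
apply: fine_dist_le; try exact: Lnorm_fin_num.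
  apply: speed_le_add; [exact: cx|exact: cy|exact: cxy|].
  by apply: ae_imply dxy => s h /h[_ ->]; exact: enorm_le_subD.
apply: speed_le_add; [exact: cy|exact: cx|exact: cxy|].
by apply: ae_imply dxy => s h /h[_ ->]; rewrite enormB; exact: enorm_le_subD.
Qed.

Let W1_eq x y : (forall s, - r <= s <= 0 -> x s = y s) -> in_W1 r p x ->
  in_W1 r p y.
Proof.
move=> xy [acx dx _ Lx]; apply: in_W1I.
- exact: abs_continuous_eq acx.
- apply: ae_imply dx => s h sr; apply: near_eq_derivable (h sr).
  exact: near_eq_itv sr.
- by rewrite LnormE -(eq_speed xy).
Qed.

Let derive1_cst0 s : derive1 (cst 0 : R -> 'rV[R]_n) s = 0.
Proof. exact: derive1_cst. Qed.

Let Lnorm_cst0 : Lnorm_derivative r p (cst 0 : R -> 'rV[R]_n) = 0%E.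
Proof.
rewrite LnormE (_ : EFin \o _ = cst 0%E) ?Lnorm0//.
  by rewrite gt_eqF// (lt_le_trans lte01).
apply/funext => s; rewrite /= /speed patchE derive1_cst0 enorm0.
by case: ifP.
Qed.

(** The derivative of [history z t] at s is z'(t + s). It is the shifted
    derivative of the initial piece for s < - t, and at most C for s > - t. *)
Let speed_history z (C t : R) : 0 <= C -> 0 <= t ->
  (forall s, 0 < s < t -> exists2 d, is_derive s 1 z d & enorm d <= C) ->
  forall s, s \in `]- r, 0[ -> s != - t ->
  speed (history z t) s <= speed z (t + s) + (cst C \_ `]- r, 0[) s.
Proof.
move=> C0 t0 dz s sr st; rewrite (speedE _ sr) derive1_history.
rewrite in_itv/= in sr; case/andP: sr => rs s0.
have rts : - r < t + s by rewrite (lt_le_trans rs)// lerDr.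
have := st; rewrite -subr_eq0 opprK addrC neq_lt => /orP[ts0|ts0].
  rewrite speedE ?in_itv/= ?rts ?ts0// lerDl patchE.
  by case: ifP.
have [|d [_ zd] dC] := dz (t + s); first by rewrite ts0 gtrDl.
rewrite derive1E zd (le_trans dC)// patchE mem_set/= ?in_itv/= ?rs ?s0//.
by rewrite lerDr.
Qed.

(** The p-norm of the derivative of [history z t] is at most that of the shifted
    derivative of the initial piece plus that of the constant C, by Minkowski's
    inequality, and Lebesgue measure is invariant under the shift. *)
Lemma W1_shift_stable : shift_stable r (W1 n r p).
Proof.
split=> [x /in_W1_C0//|x wx /=|x y|x y wx wy /=|x y xy wx|||].
- by rewrite lerDl fine_ge0// LnormE; exact: Lnorm_ge0.
- exact: W1_sub.
- have cx := in_W1_C0 wx; have cy := in_W1_C0 wy.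
  rewrite opprD addrACA; apply: le_trans (ler_normD _ _) _.
  apply: lerD; first exact: (supnorm_dist_le r_ge0 cx cy).
  exact: (W1_Lnorm_lip wx wy).
- split; first exact: W1_eq wx.
  by rewrite /= (eq_supnorm xy) !LnormE (eq_speed xy).
- apply: in_W1I; first exact: abs_continuous_cst0.
    by apply/nearW => s _; exact: derivable_cst.
  by rewrite Lnorm_cst0.
- by rewrite /= supnorm_cst0// Lnorm_cst0 addr0.
have [kappa kappa0 hkappa] := Lnorm_cst_itv_le (- r) 0 p_ge1.
exists kappa; first exact: kappa0.
move=> z C t C0 t0 cz wz dz; rewrite /= in wz *.
have [acz diffz _ Lz] := wz; have cz0 := in_W1_C0 wz.
have cht := in_C0_history t0 cz.
have Lh : (Lnorm_derivative r p (history z t) <=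
    Lnorm_derivative r p z + (kappa * C)%:E)%E.
  have mz := measurable_speed cz0.
  have mC : measurable_fun [set: R] (cst C \_ `]- r, 0[%classic).
    by apply/measurable_restrict => //; rewrite setTI; exact: measurable_cst.
  have mzt : measurable_fun [set: R] (speed z \o (fun s => t + s)).
    by apply: measurableT_comp; [exact: mz|exact: measurable_shift].
  have le_sum := leeD (Lnorm_shift_le t p_ge1 mz) (hkappa C C0).
  apply: le_trans _ le_sum.
  rewrite LnormE.
  apply: Lnorm_ae_le_add; [exact: p_ge1| |exact: mzt|exact: mC|].
    exact: measurable_speed.
  apply: ae_imply (ae_neq (- t)) => s st.
  have rhs0 : 0 <= speed z (t + s) + (cst C \_ `]- r, 0[) s.
    apply: addr_ge0; first exact: speed_ge0.
    by rewrite patchE; case: ifP => _; [exact: C0|exact: lexx].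
  rewrite /= !ger0_norm//.
  have [sr|sr] := boolP (s \in `]- r, 0[); first exact: speed_history.
  by rewrite speed_out.
have wh : in_W1 r p (history z t).
  apply: in_W1I.
  - exact: (abs_continuous_history r_ge0 t0 C0 cz dz acz).
  - apply: ae_imply (ae_and (ae_shift t diffz) (ae_neq (- t))) => s [h st] sr.
    apply/derivable_history; move: sr; rewrite in_itv/= => /andP[rs s0].
    have rts : - r < t + s by rewrite (lt_le_trans rs)// lerDr.
    have := st; rewrite -subr_eq0 opprK addrC neq_lt => /orP[ts0|ts0].
      by apply: h; rewrite in_itv/= rts.
    by have [|d [dz' _] _] := dz (t + s); first by rewrite ts0 gtrDl.
  - by rewrite (le_lt_trans Lh)// lte_add_pinfty// ltry.
split=> //=; rewrite -addrA lerD2l.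
have : fine (Lnorm_derivative r p (history z t)) <=
    fine (Lnorm_derivative r p z) + kappa * C.
  exact: fine_le_add (Lnorm_fin_num wh) (Lnorm_fin_num wz) Lh.
by move/le_trans; apply; rewrite lerD2r lerDr supnorm_ge0.
Qed.

End SobolevSpace.

(** * The equivalence *)

Section Equivalence.
Context {R : realType} {n : nat} (r : R) (f : (R -> 'rV[R]_n) -> 'rV[R]_n).
Variable X : funspace R n.
Hypotheses (r_ge0 : 0 <= r) (f0 : f (cst 0) = 0).
Hypothesis f_lip : lipschitz_bounded_C0 r f.
Hypothesis stableX : shift_stable r X.
Implicit Types x y : R -> 'rV[R]_n.

Local Notation N := (fs_norm X).
Local Notation mem := (fs_mem X).

Let N_ge0 x : mem x -> 0 <= N x.
Proof.
move=> mx; apply: le_trans (stable_supnorm_le stableX mx).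
exact: (supnorm_ge0 r_ge0 (stable_C0 stableX mx)).
Qed.

Let mem_solution x0 x : mem x0 -> global_solution r f x0 x ->
  mem x /\ N x = N x0.
Proof.
move=> mx0 sol.
have [|mx ->] := stable_eq stableX (y := x) _ mx0; last by split; [exact: mx|].
by move=> s sr; rewrite (global_solution_init sol sr).
Qed.

Lemma mem_history x0 x (t : R) : mem x0 -> global_solution r f x0 x -> 0 <= t ->
  mem (history x t).
Proof.
move=> mx0 sol t0.
have [C C0 dx] := solution_derivative_bound r_ge0 f0 f_lip t0 sol.
have [kappa _ stab] := stable_history stableX.
have [mx _] := mem_solution mx0 sol.
by have [] := stab x C t C0 t0 (global_solution_continuous sol) mx dx.
Qed.

(** With b inverse to a1, the bound is b(exp(-t) a2(s)). *)
Lemma UGAS_of_lyapunov (V : (R -> 'rV[R]_n) -> R) (a1 a2 : R -> R) :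
  classKinf a1 -> classKinf a2 ->
  (forall x, mem x -> a1 (N x) <= V x <= a2 (N x) /\ decays_along r f V x) ->
  UGAS r f X.
Proof.
move=> Ka1 [Ka2 _] hV; have [b Kb bK] := classKinf_inverse Ka1.
exists (fun s t => b (expR (- t) * a2 s)); first exact: classKL_expR.
move=> x0 mx0; have [/andP[_ Va2] [x sol dec]] := hV x0 mx0.
exists x; first exact: sol.
move=> t t0; have mxt := mem_history mx0 sol t0.
have [/andP[a1V _] _] := hV _ mxt.
rewrite -[leLHS]bK; last exact: N_ge0.
apply: classK_le; first exact: Kb.
  by apply: classK_ge0; [case: Ka1|exact: N_ge0].
apply: le_trans a1V _; apply: le_trans (dec t t0) _.
by rewrite ler_wpM2l ?expR_ge0.
Qed.

(** The flow is Lipschitz on bounded sets of X, uniformly on bounded time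
    intervals: the regularity estimate for the difference of two solutions
    carries their closeness in C^0 over to X. *)
Let flow_lip (sigma : R -> R -> R) (sol : (R -> 'rV[R]_n) -> R -> 'rV[R]_n) :
  classKL sigma ->
  (forall x, mem x -> global_solution r f x (sol x)) ->
  (forall x t, mem x -> 0 <= t -> N (history (sol x) t) <= sigma (N x) t) ->
  forall (S : R) (k : nat), exists2 B : R, 0 <= B &
    forall x y, mem x -> mem y -> N x <= k%:R -> N y <= k%:R ->
    forall t, 0 <= t <= S ->
      `|N (history (sol x) t) - N (history (sol y) t)| <= B * N (x - y).
Proof.
move=> [Ksig sig] solP sigP S k; pose rho := sigma k%:R 0.
have rho0 : 0 <= rho by exact: (classK_ge0 (Ksig 0 (lexx _)) (ler0n _ _)).
have [C C0 dist] := solutions_dist r_ge0 f_lip S rho0.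
have [kappa kappa0 stab] := stable_history stableX.
exists (C + 1 + kappa * C); first by rewrite !addr_ge0// mulr_ge0.
move=> x y mx my xk yk t /andP[t0 tS].
have bounded z : mem z -> N z <= k%:R -> forall u, 0 <= u <= S ->
    supnorm r (history (sol z) u) <= rho.
  move=> mz zk u /andP[u0 _]; have mzu := mem_history mz (solP z mz) u0.
  apply: le_trans (stable_supnorm_le stableX mzu) _.
  apply: le_trans (sigP z u mz u0) _.
  apply: le_trans (classK_le (Ksig u u0) (N_ge0 mz) zk) _.
  by have [+ _] := sig k%:R (ler0n _ _); apply.
have [near_xy dxy] := dist x y _ _ (solP x mx) (solP y my)
  (bounded x mx xk) (bounded y my yk).
set z := sol x - sol y in near_xy dxy.
have [msx _] := mem_solution mx (solP x mx).
have [msy _] := mem_solution my (solP y my).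
have mz : mem z by exact: (stable_sub stableX msx msy).
have mxy : mem (x - y) by exact: (stable_sub stableX mx my).
have Nz : N z = N (x - y).
  have [|_ ->] := stable_eq stableX (y := x - y) _ mz; last by [].
  move=> s sr; rewrite /z !fctE (global_solution_init (solP x mx) sr).
  by rewrite (global_solution_init (solP y my) sr).
have S0 : 0 <= supnorm r (x - y).
  exact: (supnorm_ge0 r_ge0 (stable_C0 stableX mxy)).
have SN := stable_supnorm_le stableX mxy.
have cz : {within `[- r, +oo[, continuous z}.
  apply: within_continuousB.
    exact: (global_solution_continuous (solP x mx)).
  exact: (global_solution_continuous (solP y my)).
have dzt s : 0 < s < t -> exists2 d, is_derive s 1 z d &
    enorm d <= C * supnorm r (x - y).
  by move=> /andP[s0 st]; apply: dxy; rewrite s0 (lt_le_trans st).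
have [_ Nzt] := stab z _ t (mulr_ge0 C0 S0) t0 cz mz dzt.
have mxt := mem_history mx (solP x mx) t0.
have myt := mem_history my (solP y my) t0.
apply: le_trans (stable_norm_lip stableX mxt myt) _.
apply: le_trans Nzt _; rewrite Nz.
have supz : supnorm r (history z t) <= C * supnorm r (x - y).
  apply: (supnorm_le r_ge0) => s /andP[rs s0]; apply: near_xy.
  by rewrite (le_trans rs) ?lerDr//= (le_trans _ tS)// gerDl.
have CSN : C * supnorm r (x - y) <= C * N (x - y) by exact: ler_wpM2l.
rewrite !mulrDl mul1r; apply: lerD; first by rewrite lerD2r (le_trans supz).
by rewrite -mulrA; exact: ler_wpM2l.
Qed.

Lemma lyapunov_of_UGAS : UGAS r f X ->
  exists (V : (R -> 'rV[R]_n) -> R) (a1 a2 : R -> R),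
    [/\ forall x, mem x -> 0 <= V x, lipschitz_bounded X V, classKinf a1,
        classKinf a2 &
        forall x, mem x -> a1 (N x) <= V x <= a2 (N x) /\ decays_along r f V x].
Proof.
move=> [sigma KLsig ugas].
have ex x0 : exists x, mem x0 -> global_solution r f x0 x /\
    forall t : R, 0 <= t -> N (history x t) <= sigma (N x0) t.
  have [/ugas[x sol bx]|nm] := pselect (mem x0); first by exists x.
  by exists x0 => /nm.
have [sol solsig] := choice ex.
have solP x : mem x -> global_solution r f x (sol x) by move=> /solsig[].
have sigP x (t : R) : mem x -> 0 <= t -> N (history (sol x) t) <= sigma (N x) t.
  by move=> /solsig[_]; apply.
have mem0 := stable_cst0 stableX.
have [||||||||||V [a1 [a2 [V0 Vlip Ka1 Ka2 hV]]]] :=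
  @converse_lyapunov R _ N (fun x y => N (x - y)) mem
    (fun t x => history (sol x) t) sigma (cst 0).
- exact: N_ge0.
- by move=> x y mx my; apply: N_ge0; exact: (stable_sub stableX mx my).
- by move=> x mx; rewrite history0; have [] := mem_solution mx (solP x mx).
- move=> x s t mx s0 t0; rewrite -history_add.
  have mxt := mem_history mx (solP x mx) t0.
  have mxts := mem_history mxt (solP _ mxt) s0.
  have [|_ ->] := stable_eq stableX (y := history (history (sol x) t) s) _ mxts;
    last by [].
  move=> u /andP[ru u0].
  apply: (global_solution_unique r_ge0 f_lip (solP _ mxt)).
  + exact: (global_solution_history t0 (solP x mx)).
  + by [].
  + by rewrite (le_trans ru)// lerDr.
- exact: KLsig.
- exact: sigP.
- exact: (flow_lip KLsig solP sigP).
- exact: mem0.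
- exact: (stable_norm0 stableX).
- by move=> x mx; congr N; apply/funext => s; rewrite !fctE subr0.
exists V, a1, a2; split; [exact: V0|exact: Vlip|exact: Ka1|exact: Ka2|].
move=> x mx; have [hx dec] := hV x mx; split; first exact: hx.
by exists (sol x); [exact: solP|exact: dec].
Qed.

End Equivalence.

Theorem theorem5 (R : realType) (n : nat) (r : R)
    (f : (R -> 'rV[R]_n) -> 'rV[R]_n) (p : \bar R) (X : funspace R n) :
  0 < r ->
  f (cst 0) = 0 ->
  lipschitz_bounded_C0 r f ->
  (1 < p)%E ->
  X = W1 n r p \/ X = C0a n r (1 - recip p) ->
  (UGAS r f X <->
   exists (V : (R -> 'rV[R]_n) -> R) (a1 a2 : R -> R),
    [/\ forall x, fs_mem X x -> 0 <= V x,
        lipschitz_bounded X V,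
        classKinf a1,
        classKinf a2
      & forall x, fs_mem X x ->
          a1 (fs_norm X x) <= V x <= a2 (fs_norm X x) /\
          decays_along r f V x]).
Proof.
move=> r0 f0 f_lip p1 hX; have r_ge0 := ltW r0.
have stableX : shift_stable r X.
  case: hX => ->; first by apply: W1_shift_stable => //; exact: ltW.
  have recip01 : 0 <= recip p <= 1.
    case: p p1 => //= [q|_]; last by rewrite lexx ler01.
    rewrite lte_fin => q1; have q0 : 0 < q by rewrite (lt_trans ltr01).
    by rewrite invr_ge0 (ltW q0)/= invf_le1// ltW.
  case/andP: recip01 => p0 p1'.
  by apply: C0a_shift_stable => //; [rewrite subr_ge0|rewrite gerBl].
split; first exact: (lyapunov_of_UGAS r_ge0 f0 f_lip stableX).
move=> [V [a1 [a2 [_ _ Ka1 Ka2 hV]]]].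
exact: (UGAS_of_lyapunov r_ge0 f0 f_lip stableX Ka1 Ka2 hV).
Qed.
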